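(* (i) Let $H_\alpha=\Delta_\alpha+Q$ be the magnetic Schrödinger operator on a periodic graph $\mathcal G$, let $\mathfrak m\in\mathscr F(\kappa)$ be a minimal form on the fundamental graph $G_*=(\mathcal V_*,\mathcal E_* )$, and let $\nu=\#\mathcal V_*$. Then each band $\sigma_n(H_\alpha)$, $n=1,\ldots,\nu$, satisfies $$\sigma_n(H_\alpha)\subset\big[\mu_{\alpha,n},\,\mu_{\alpha,n}+2\varkappa_+^{\mathfrak m}\big],\qquad \varkappa_+^{\mathfrak m}=\max_{v\in\mathcal V_*}\varkappa_v^{\mathfrak m},$$ where $\mu_{\alpha,1}\le\ldots\le\mu_{\alpha,\nu}$ are the eigenvalues (counting multiplicities) of the magnetic Schrödinger operator $H^0_\alpha=\Delta^0_\alpha+Q$ on the finite graph $G^0_{\mathfrak m}$, and $\varkappa^{\mathfrak m}_v$ is the degree of $v$ in the graph $G_{\mathfrak m}$. (ii) The Lebesgue measure of the spectrum of $H_\alpha$ satisfies $$|\sigma(H_\alpha)|\le\sum_{n=1}^{\nu}|\sigma_n(H_\alpha)|\le4\mathcal I,\qquad \mathcal I=\tfrac12\#\operatorname{supp}\mathfrak m.$$ (iii) There exists a periodic graph $\mathcal G$ such that the estimate in (ii) becomes an identity, i.e. $|\sigma(H_\alpha)|=\sum_{n=1}^{\nu}|\sigma_n(H_\alpha)|=4\mathcal I$, for any potentials $Q$ and $\alpha$.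
   Context: Periodic graphs. $\Gamma\subset\mathbb R^d$ is a lattice of rank $d$ with basis $a_1,\ldots,a_d$. For $x=\sum_s t_sa_s\in\mathbb R^d$ write $x_{\mathbb A}=(t_1,\ldots,t_d)$. $\mathcal G=(\mathcal V,\mathcal E)$ is a connected infinite locally finite graph (loops and multiple edges allowed) embedded in $\mathbb R^d$, with $\mathcal G+a=\mathcal G$ for all $a\in\Gamma$ and finite quotient graph $G_*=\mathcal G/\Gamma=(\mathcal V_*,\mathcal E_* )$, the fundamental graph. $\mathcal A$ and $\mathcal A_*$ are the sets of oriented edges of $\mathcal G$ and $G_*$ (each unoriented edge has two orientations); $\underline{\mathbf e}$ is the inverse of $\mathbf e$; $(v,u)$ denotes an oriented edge from $v$ to $u$. The degree $\varkappa_v$ is the number of oriented edges starting at $v$ (a loop contributes 2). Operators. A magnetic potential is $\alpha:\mathcal A\to\mathbb R$ with $\alpha(\underline{\mathbf e})=-\alpha(\mathbf e)$, $\alpha(\mathbf e+a)=\alpha(\mathbf e)$ for $a\in\Gamma$; $Q:\mathcal V\to\mathbb R$ is $\Gamma$-periodic and acts by multiplication. On $\ell^2(\mathcal V)$, $(\Delta_\alpha f)(v)=\sum_{\mathbf e=(v,u)\in\mathcal A}(f(v)-e^{i\alpha(\mathbf e)}f(u))$ and $H_\alpha=\Delta_\alpha+Q$. The potentials induce functions $\alpha$ on $\mathcal A_*$ and $Q$ on $\mathcal V_*$. Forms. A 1-form on a finite connected graph with oriented edge set $A$ is $\mathfrak b:A\to\mathbb R^n$ with $\mathfrak b(\underline{\mathbf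 e})=-\mathfrak b(\mathbf e)$. The flux through a cycle $\mathbf c$ is $\Phi_{\mathfrak b}(\mathbf c)=\sum_{\mathbf e\in\mathbf c}\mathfrak b(\mathbf e)$. $\mathscr F(\mathbf x)$ is the set of 1-forms $\mathfrak b$ with $\Phi_{\mathfrak b}=\Phi_{\mathbf x}$ on the cycle space. A form $\mathfrak m\in\mathscr F(\mathbf x)$ is minimal if $\#\operatorname{supp}\mathfrak m\le\#\operatorname{supp}\mathfrak b$ for all $\mathfrak b\in\mathscr F(\mathbf x)$. The coordinate form $\kappa:\mathcal A_*\to\mathbb R^d$ is induced by $\kappa(\mathbf e)=v_{\mathbb A}-u_{\mathbb A}$ for $\mathbf e=(u,v)\in\mathcal A$. For the magnetic form $\alpha:\mathcal A_*\to\mathbb R$ fluxes are taken modulo $2\pi$: $\mathscr F(\alpha)$ is the set of real 1-forms on $G_*$ with the same fluxes as $\alpha$ modulo $2\pi$. Bands. For minimal forms $(\mathfrak m,\phi)\in\mathscr F(\kappa)\times\mathscr F(\alpha)$ and $\vartheta\in\mathbb T^d=\mathbb R^d/(2\pi\mathbb Z)^d$, the fiber operator is $H_{\mathfrak m,\phi}(\vartheta)=\Delta_{\mathfrak m,\phi}(\vartheta)+Q$ on $\ell^2(\mathcal V_* )$, with $(\Delta_{\mathfrak m,\phi}(\vartheta)f)(v)=\varkappa_vf(v)-\sum_{\mathbf e=(v,u)\in\mathcal A_*}e^{i(\phi(\mathbf e)+\langle\mathfrak m(\mathbf e),\vartheta\rangle)}f(u)$. Its eigenvalues $\lambda_{\alpha,1}(\vartheta)\le\ldots\le\lambda_{\alpha,\nu}(\vartheta)$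 (with multiplicity) do not depend on the choice of minimal forms; the band is $\sigma_n(H_\alpha)=\lambda_{\alpha,n}(\mathbb T^d)$, a compact interval, and $\sigma(H_\alpha)=\bigcup_{n=1}^\nu\sigma_n(H_\alpha)$. Subgraphs. Fix an orientation of each edge of $\mathcal E_*$ and let $\mathcal E_{\mathfrak m}=\mathcal E_*\cap\operatorname{supp}\mathfrak m$ (the unoriented edges on which $\mathfrak m\ne0$), $G_{\mathfrak m}=(\mathcal V_*,\mathcal E_{\mathfrak m})$, $G^0_{\mathfrak m}=(\mathcal V_*,\mathcal E_*\setminus\mathcal E_{\mathfrak m})$. $\Delta^0_\alpha$ is the magnetic Laplacian on $G^0_{\mathfrak m}$ with potential $\alpha$: $(\Delta^0_\alpha f)(v)=\sum_{\mathbf e=(v,u)}(f(v)-e^{i\alpha(\mathbf e)}f(u))$, the sum over oriented edges of $G^0_{\mathfrak m}$ starting at $v$. *)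

(* Defs.v *)
From HB Require Import structures.
From mathcomp Require Import all_boot all_order all_algebra complex.
From mathcomp Require Import all_classical all_reals all_analysis.

Set Implicit Arguments.
Unset Strict Implicit.
Unset Printing Implicit Defensive.

Import Order.TTheory GRing.Theory Num.Theory.
Import numFieldNormedType.Exports.

Local Open Scope classical_set_scope.
Local Open Scope ring_scope.

(* Multigraphs given by their oriented edges: every unoriented edge, loops     *)
(* included, is a pair {e, inv e} of distinct oriented edges.                  *)
Record multigraph (V E : Type) := Multigraph {
  src : E -> V;
  tgt : E -> V;
  inv : E -> E;
  invK : involutive inv;
  inv_neq : forall e, inv e <> e;
  src_inv : forall e, src (inv e) = tgt e }.

Section Multigraph.
Context {V E : Type} (G : multigraph V E).

Fixpoint walk (u : V) (p : seq E) (v : V) : Prop :=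
  if p is e :: p' then src G e = u /\ walk (tgt G e) p' v else u = v.

Definition connected_graph := forall u v, exists p, walk u p v.

Definition locally_finite := forall v, finite_set [set e | src G e = v].

Definition one_form (W : zmodType) (b : E -> W) :=
  forall e, b (inv G e) = - b e.

Definition is_cycle (c : seq E) := exists v, walk v c v.

Definition flux (W : zmodType) (b : E -> W) (c : seq E) : W :=
  \sum_(e <- c) b e.

Definition same_flux (W : zmodType) (x b : E -> W) :=
  one_form b /\ forall c, is_cycle c -> flux b c = flux x c.

Definition same_flux_mod2pi (R : realType) (x b : E -> R) :=
  one_form b /\
  forall c, is_cycle c ->
    exists k : int, flux b c = flux x c + 2 * pi * k%:~R.

End Multigraph.

Section Lattice.
Context {R : realType} {d : nat}.

(* The rows of B are the basis vectors of the lattice. *)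
Definition lattice_point (B : 'M[R]_d) (k : 'rV[int]_d) : 'rV[R]_d :=
  map_mx intr k *m B.

Definition lattice_coord (B : 'M[R]_d) (x : 'rV[R]_d) : 'rV[R]_d :=
  x *m invmx B.

Definition inner (x y : 'rV[R]_d) : R := \sum_s x ord0 s * y ord0 s.

End Lattice.

(* A Z^d-vector k acts on the graph as the translation by lattice_point basis  *)
(* k.  Vertices are distinct points of R^d.  Edges are only recorded by their  *)
(* endpoints, inverses and translates, so that multiple edges stay distinct.   *)
(* The quotient graph is given by its universal data: a finite graph and a     *)
(* surjective graph morphism whose fibers are the orbits of the translations.  *)
Record periodic_graph (R : realType) (d : nat) := PeriodicGraph {
  basis : 'M[R]_d;
  basis_unit : basis \in unitmx;
  vert : choiceType;
  edge : choiceType;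
  graph : multigraph vert edge;
  graph_connected : connected_graph graph;
  graph_infinite : infinite_set [set: vert];
  graph_locally_finite : locally_finite graph;
  pos : vert -> 'rV[R]_d;
  pos_inj : injective pos;
  vshift : 'rV[int]_d -> vert -> vert;
  eshift : 'rV[int]_d -> edge -> edge;
  pos_vshift : forall k v, pos (vshift k v) = pos v + lattice_point basis k;
  eshift0 : forall e, eshift 0 e = e;
  eshiftD : forall k l e, eshift (k + l) e = eshift k (eshift l e);
  src_eshift : forall k e, src graph (eshift k e) = vshift k (src graph e);
  inv_eshift : forall k e, inv graph (eshift k e) = eshift k (inv graph e);
  qvert : finType;
  qedge : finType;
  qgraph : multigraph qvert qedge;
  vproj : vert -> qvert;
  eproj : edge -> qedge;
  vproj_surj : forall w, exists v, vproj v = w;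
  eproj_surj : forall f, exists e, eproj e = f;
  vproj_eq : forall u v, vproj u = vproj v <-> exists k, v = vshift k u;
  eproj_eq : forall e f, eproj e = eproj f <-> exists k, f = eshift k e;
  src_eproj : forall e, src qgraph (eproj e) = vproj (src graph e);
  inv_eproj : forall e, inv qgraph (eproj e) = eproj (inv graph e) }.

Section Potentials.
Context {R : realType} {d : nat} (G : periodic_graph R d).

Definition magnetic_potential (alpha : edge G -> R) :=
  one_form (graph G) alpha /\ forall k e, alpha (eshift k e) = alpha e.

Definition electric_potential (Q : vert G -> R) :=
  forall k v, Q (vshift k v) = Q v.

(* Functions on the quotient induced by periodic functions. *)
Definition vinduced (T : Type) (x : vert G -> T) (w : qvert G) : T :=
  x (projT1 (cid (vproj_surj w))).

Definition einduced (T : Type) (x : edge G -> T) (f : qedge G) : T :=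
  x (projT1 (cid (eproj_surj f))).

Lemma vinducedE (T : Type) (x : vert G -> T) :
  (forall k v, x (vshift k v) = x v) -> forall v, vinduced x (vproj v) = x v.
Proof.
move=> xP v; rewrite /vinduced; case: cid => u /= /vproj_eq[k ->].
by rewrite xP.
Qed.

Lemma einducedE (T : Type) (x : edge G -> T) :
  (forall k e, x (eshift k e) = x e) -> forall e, einduced x (eproj e) = x e.
Proof.
move=> xP e; rewrite /einduced; case: cid => u /= /eproj_eq[k ->].
by rewrite xP.
Qed.

Definition edge_coord (e : edge G) : 'rV[R]_d :=
  lattice_coord (basis G) (pos (tgt (graph G) e))
  - lattice_coord (basis G) (pos (src (graph G) e)).

Lemma edge_coord_shift k e : edge_coord (eshift k e) = edge_coord e.
Proof.
rewrite /edge_coord -!src_inv inv_eshift !src_eshift !pos_vshift.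
by rewrite /lattice_coord !mulmxDl opprD addrACA subrr addr0.
Qed.

Definition coordinate_form : qedge G -> 'rV[R]_d := einduced edge_coord.

Lemma coordinate_formE e : coordinate_form (eproj e) = edge_coord e.
Proof. by rewrite /coordinate_form einducedE //; exact: edge_coord_shift. Qed.

End Potentials.

Definition expi {R : realType} (t : R) : R[i] := (cos t +i* sin t)%C.

Section Ell2.
Context {R : realType} {V : choiceType}.

Definition normsq (z : R[i]) : R := complex.Re z ^+ 2 + complex.Im z ^+ 2.

Definition ell2_normsq (f : V -> R[i]) : \bar R :=
  \esum_(v in [set: V]) (normsq (f v))%:E.

Definition ell2 (f : V -> R[i]) := (ell2_normsq f < +oo)%E.

Definition bounded_on_ell2 (S : (V -> R[i]) -> V -> R[i]) :=
  exists M : R, forall f, ell2 f -> (ell2_normsq (S f) <= M%:E * ell2_normsq f)%E.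

(* T is meant to be a bounded linear operator on ell2. *)
Definition resolvent_set (T : (V -> R[i]) -> V -> R[i]) : set R[i] :=
  [set z | exists S, bounded_on_ell2 S /\
     forall f, ell2 f ->
       S (fun v => T f v - z * f v) = f /\
       (fun v => T (S f) v - z * S f v) = f].

Definition spectrum (T : (V -> R[i]) -> V -> R[i]) : set R[i] :=
  ~` resolvent_set T.

(* For a self-adjoint T this is the whole spectrum. *)
Definition real_spectrum (T : (V -> R[i]) -> V -> R[i]) : set R :=
  [set x | spectrum T x%:C%C].

End Ell2.

Definition magnetic_schrodinger {R : realType} {d : nat} (G : periodic_graph R d)
    (alpha : edge G -> R) (Q : vert G -> R) (f : vert G -> R[i]) (v : vert G) : R[i] :=
  \sum_(e \in [set e | src (graph G) e = v])
     (f v - expi (alpha e) * f (tgt (graph G) e))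
  + (Q v)%:C%C * f v.

(* Real parts of the roots of the characteristic polynomial, repeated          *)
(* according to multiplicity; meant for Hermitian matrices.                    *)
Definition eigenvalues {R : realType} {n : nat} (M : 'M[R[i]]_n) : seq R :=
  sort <=%R [seq complex.Re z | z <- sval (closed_field_poly_normal (char_poly M))].

Section FiniteOperators.
Context {R : realType} {V E : finType} (G : multigraph V E).

(* Subgraphs with all the vertices are given by their set D of oriented edges, *)
(* closed under inversion.                                                     *)
Definition degree (D : {set E}) (v : V) : nat := #|[set e in D | src G e == v]|.

Definition finite_magnetic_schrodinger (D : {set E}) (alpha : E -> R) (Q : V -> R)
    (f : V -> R[i]) (v : V) : R[i] :=
  \sum_(e in D | src G e == v) (f v - expi (alpha e) * f (tgt G e))
  + (Q v)%:C%C * f v.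

Definition fiber_operator {d : nat} (m : E -> 'rV[R]_d) (phi : E -> R) (Q : V -> R)
    (theta : 'rV[R]_d) (f : V -> R[i]) (v : V) : R[i] :=
  (degree [set: E] v)%:R * f v
  - \sum_(e | src G e == v) expi (phi e + inner (m e) theta) * f (tgt G e)
  + (Q v)%:C%C * f v.

Definition operator_mx (T : (V -> R[i]) -> V -> R[i]) : 'M[R[i]]_#|V| :=
  \matrix_(i, j) T (fun v => (v == enum_val j)%:R) (enum_val i).

Definition supp (W : zmodType) (b : E -> W) : {set E} := [set e | b e != 0].

Definition minimal_in (W : zmodType) (F : (E -> W) -> Prop) (m : E -> W) :=
  F m /\ forall b, F b -> (#|supp m| <= #|supp b|)%N.

End FiniteOperators.

Section Bands.
Context {R : realType} {d : nat} (G : periodic_graph R d).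

Definition minimal_coordinate_form (m : qedge G -> 'rV[R]_d) :=
  minimal_in (same_flux (qgraph G) (coordinate_form (G := G))) m.

Definition minimal_magnetic_form (alpha : edge G -> R) (phi : qedge G -> R) :=
  minimal_in (same_flux_mod2pi (qgraph G) (einduced alpha)) phi.

(* Indices start from 0 here and below. *)
Definition band_function (m : qedge G -> 'rV[R]_d) (phi : qedge G -> R)
    (Q : vert G -> R) (n : nat) (theta : 'rV[R]_d) : R :=
  nth 0 (eigenvalues
    (operator_mx (fiber_operator (qgraph G) m phi (vinduced Q) theta))) n.

(* The image of the torus, theta ranging over representatives. *)
Definition band (m : qedge G -> 'rV[R]_d) (phi : qedge G -> R)
    (Q : vert G -> R) (n : nat) : set R :=
  range (band_function m phi Q n).

Definition unperturbed_eigenvalue (m : qedge G -> 'rV[R]_d)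
    (alpha : edge G -> R) (Q : vert G -> R) (n : nat) : R :=
  nth 0 (eigenvalues
    (operator_mx (finite_magnetic_schrodinger (qgraph G) (~: supp m)
                    (einduced alpha) (vinduced Q)))) n.

Definition max_degree (m : qedge G -> 'rV[R]_d) : nat :=
  (\max_(v : qvert G) degree (qgraph G) (supp m) v)%N.

(* supp m consists of oriented edges, two for each unoriented one. *)
Definition invariant_I (m : qedge G -> 'rV[R]_d) : R := #|supp m|%:R / 2.

End Bands.

(* Main.v *)
Require Import Defs.
From mathcomp Require Import all_boot all_order all_algebra complex.
From mathcomp Require Import all_classical all_reals all_analysis.
From mathcomp Require Import ring lra zify.
Import Order.TTheory GRing.Theory Num.Theory.
Import numFieldNormedType.Exports.
Local Open Scope classical_set_scope.
Local Open Scope ring_scope.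

(** The bands lie where they should because the fiber operator is the operator
    of the subgraph off the support of the minimal form plus the magnetic
    Laplacian of the support: the phases depend on the quasimomentum only on the
    support [qform_fiber]. That Laplacian is nonnegative and at most twice the
    degree in the support, since every oriented edge contributes at most half
    the squares at its two ends [hopping_form_le]. By Weyl's monotonicity, proved here by
    counting dimensions [count_eigenvalues_le], the n-th band lies between the
    n-th eigenvalues of the operator of the subgraph and of the same operator
    increased by twice the degrees. Bounding the degrees by their maximum gives
    the first estimate [band_itv]. Summing the differences of the two families
    of eigenvalues instead gives the difference of two traces, twice the sum of
    the degrees, which is the bound for the total length [sum_bands_le]. The
    bands are defined by other forms than the one in the estimates, but forms
    with the same fluxes modulo 2 pi have fiber operators that a gauge
    transformation identifies [hopping_char_poly].

    For the measure of the spectrum, the bands must cover it. Lattice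
    coordinates [place] turn the operator into one on the product of the
    quotient with the integer lattice, whose Fourier transform acts fiberwise by
    the fiber operators of an integer valued form [periodic_hopping_symbol].
    If x is in no band, the determinants of the fibers of A = H - x do not vanish
    on the compact torus, so the fibers and their inverses are uniformly bounded,
    and 1 - c A^2 is a uniform contraction of the fibers for small c
    [bloch_contraction]. On a finitely supported function the bound is carried
    over by Parseval's identity on a finite grid of quasimomenta that is fine
    enough for the support [parseval]; locality of the operator extends it to all
    square-summable functions [local_bound], and a Neumann series inverts A
    [neumann_inverse].

    Equality holds for the integer line, with one vertex and one loop in the
    quotient. After a gauge change the operator is 2 + q minus the sum of the two
    translations, and truncated plane waves of N sites, whose defect is bounded
    independently of N, put the whole interval [q, q + 4] in the spectrum
    [line_spectrum]. As the support of a form on the loop has at most two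
    oriented edges, all the terms of the chain of inequalities are then 4. *)

Set Implicit Arguments.
Unset Strict Implicit.
Unset Printing Implicit Defensive.

(* Both names are shadowed by later imports. *)
Local Notation inv := Defs.inv.
Local Notation basis := Defs.basis.

(** * Complex numbers *)

Section Complex.
Context {R : realType}.
Implicit Types (z w : R[i]) (x y t : R).

Lemma complex_split z : z = (complex.Re z +i* complex.Im z)%C.
Proof. by case: z. Qed.

Lemma ReD z w : complex.Re (z + w) = complex.Re z + complex.Re w.
Proof. by case: z; case: w. Qed.

Lemma ImD z w : complex.Im (z + w) = complex.Im z + complex.Im w.
Proof. by case: z; case: w. Qed.

Lemma ReN z : complex.Re (- z) = - complex.Re z.
Proof. by case: z. Qed.

Lemma ImN z : complex.Im (- z) = - complex.Im z.
Proof. by case: z. Qed.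

Lemma ReM z w : complex.Re (z * w) =
  complex.Re z * complex.Re w - complex.Im z * complex.Im w.
Proof. by case: z; case: w. Qed.

Lemma ImM z w : complex.Im (z * w) =
  complex.Re z * complex.Im w + complex.Im z * complex.Re w.
Proof. by case: z; case: w. Qed.

Lemma ReC z : complex.Re (z^*) = complex.Re z.
Proof. by case: z. Qed.

Lemma ImC z : complex.Im (z^*) = - complex.Im z.
Proof. by case: z. Qed.

Lemma Re_sum (I : Type) (r : seq I) (P : pred I) (F : I -> R[i]) :
  complex.Re (\sum_(i <- r | P i) F i) = \sum_(i <- r | P i) complex.Re (F i).
Proof. exact: (big_morph _ ReD). Qed.

Lemma Im_sum (I : Type) (r : seq I) (P : pred I) (F : I -> R[i]) :
  complex.Im (\sum_(i <- r | P i) F i) = \sum_(i <- r | P i) complex.Im (F i).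
Proof. exact: (big_morph _ ImD). Qed.

Lemma Re_realM x z : complex.Re (x%:C%C * z) = x * complex.Re z.
Proof. by case: z => a b /=; rewrite mul0r subr0. Qed.

Lemma conj_real x : (x%:C%C : R[i])^* = x%:C%C.
Proof. exact: conjc_real. Qed.

Lemma normsq_ge0 z : 0 <= normsq z.
Proof. by rewrite addr_ge0 ?sqr_ge0. Qed.

Lemma normsq0 : normsq (0 : R[i]) = 0.
Proof. by rewrite /normsq/= expr0n addr0. Qed.

Lemma normsq_eq0 z : (normsq z == 0) = (z == 0).
Proof. by rewrite /normsq paddr_eq0 ?sqr_ge0// !sqrf_eq0 eq_complex. Qed.

Lemma normsqM z w : normsq (z * w) = normsq z * normsq w.
Proof. by rewrite /normsq ReM ImM; ring. Qed.

Lemma normsqN z : normsq (- z) = normsq z.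
Proof. by rewrite /normsq ReN ImN !sqrrN. Qed.

Lemma normsq_conj z : normsq (z^*) = normsq z.
Proof. by rewrite /normsq ReC ImC sqrrN. Qed.

Lemma normsq_real x : normsq (x%:C%C : R[i]) = x ^+ 2.
Proof. by rewrite /normsq/= expr0n addr0. Qed.

Lemma normsqE z : (normsq z)%:C%C = z^* * z.
Proof.
case: z => a b; apply/eqP; rewrite eq_complex /normsq /=.
by apply/andP; split; apply/eqP; ring.
Qed.

Lemma normsqD z w :
  normsq (z + w) = normsq z + normsq w + 2 * complex.Re (z^* * w).
Proof. by rewrite /normsq ReM ReC ImC ReD ImD; ring. Qed.

Lemma normsq_addsub z w :
  normsq (z + w) + normsq (z - w) = 2 * normsq z + 2 * normsq w.
Proof. by rewrite /normsq !ReD !ImD !ReN !ImN; ring. Qed.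

Lemma normsqD_le z w : normsq (z + w) <= 2 * normsq z + 2 * normsq w.
Proof. by rewrite -normsq_addsub lerDl normsq_ge0. Qed.

Lemma Re_sqr_le_normsq z : complex.Re z ^+ 2 <= normsq z.
Proof. by rewrite /normsq lerDl sqr_ge0. Qed.

Lemma Im_sqr_le_normsq z : complex.Im z ^+ 2 <= normsq z.
Proof. by rewrite /normsq lerDr sqr_ge0. Qed.

(** With [c] the sum on the left, the squares of the moduli of
    [x * (a i)^* - c^* * b i] add up to a quadratic polynomial in the real
    variable [x], whose nonnegativity at its minimum is the inequality. *)
Lemma cauchy_schwarz (I : Type) (r : seq I) (P : pred I) (a b : I -> R[i]) :
  normsq (\sum_(i <- r | P i) a i * b i) <=
  (\sum_(i <- r | P i) normsq (a i)) * (\sum_(i <- r | P i) normsq (b i)).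
Proof.
set A := \sum_(i <- r | P i) normsq (a i).
set B := \sum_(i <- r | P i) normsq (b i).
set c := \sum_(i <- r | P i) a i * b i.
have A0 : 0 <= A by apply: sumr_ge0 => i _; exact: normsq_ge0.
have c0 := normsq_ge0 c.
have pos x : 0 <= x ^+ 2 * A + normsq c * B - 2 * x * normsq c.
  have -> : x ^+ 2 * A + normsq c * B - 2 * x * normsq c =
      \sum_(i <- r | P i) normsq (x%:C%C * (a i)^* - c^* * b i).
    have -> : 2 * x * normsq c =
        \sum_(i <- r | P i) 2 * x * complex.Re (c^* * (a i * b i)).
      by rewrite -mulr_sumr -Re_sum -mulr_sumr -normsqE.
    rewrite !mulr_sumr -big_split -sumrB; apply: eq_bigr => i _ /=.
    rewrite /normsq !(ReM, ImM, ReD, ImD, ReN, ImN, ReC, ImC)/=.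
    by ring.
  by apply: sumr_ge0 => i _; exact: normsq_ge0.
(* for A = 0 the polynomial is affine: any x beyond its zero B / 2 will do *)
have [A00|An0] := eqVneq A 0.
  by have := pos (B / 2 + 1); rewrite A00 mulr0 mul0r; nra.
have Apos : 0 < A by rewrite lt_def An0.
have [->|cn0] := eqVneq (normsq c) 0.
  by rewrite mulr_ge0// sumr_ge0// => i _; exact: normsq_ge0.
have cpos : 0 < normsq c by rewrite lt_def cn0.
have := pos (normsq c / A).
have -> : (normsq c / A) ^+ 2 * A + normsq c * B - 2 * (normsq c / A) * normsq c
  = normsq c / A * (A * B - normsq c) by field.
by rewrite pmulr_rge0 ?divr_gt0// subr_ge0.
Qed.

(** ** The exponential on the circle *)

Lemma expi0 : expi (0 : R) = 1.
Proof. by rewrite /expi cos0 sin0. Qed.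

Lemma expiD x y : expi (x + y) = expi x * expi y.
Proof.
apply/eqP; rewrite eq_complex ReM ImM /= cosD sinD eqxx /=.
by rewrite addrC [sin x * _]mulrC [cos x * sin y]mulrC addrC [cos y * _]mulrC.
Qed.

Lemma expiN x : expi (- x) = (expi x)^*.
Proof. by rewrite /expi cosN sinN. Qed.

Lemma normsq_expi x : normsq (expi x) = 1.
Proof. by rewrite /normsq/= cos2Dsin2. Qed.

Lemma expi_conjM x : (expi x)^* * expi x = 1.
Proof. by rewrite -normsqE normsq_expi. Qed.

Lemma expi_neq0 x : expi x != 0.
Proof. by rewrite -normsq_eq0 normsq_expi oner_neq0. Qed.

Lemma expi_nat n x : expi (n%:R * x) = expi x ^+ n.
Proof.
elim: n => [|n IH]; first by rewrite mul0r expi0.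
by rewrite exprS -IH -expiD; congr expi; rewrite -addn1 natrD; ring.
Qed.

Lemma expi_2pi_int (k : int) : expi (2 * pi * k%:~R : R) = 1.
Proof.
have e n : expi (2 * pi * n%:R : R) = 1.
  rewrite mulrC expi_nat (_ : expi (2 * pi) = 1) ?expr1n//.
  by rewrite /expi mulrC mulr_natr cos2pi sin2pi.
case: k => n; first exact: e.
by rewrite NegzE mulrNz mulrN expiN e conjC1.
Qed.

Lemma expi_sum (I : Type) (r : seq I) (P : pred I) (f : I -> R) :
  expi (\sum_(i <- r | P i) f i) = \prod_(i <- r | P i) expi (f i).
Proof. exact: (big_morph _ expiD expi0). Qed.

End Complex.

(** * Eigenvalues of Hermitian matrices *)

Section SortedSequences.
Context {R : realType}.

(** Two sorted sequences are compared entrywise by comparing, for every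
    threshold, how many entries lie below it: the latter does not see the
    order of the entries, hence suits the unordered roots of a polynomial. *)
Lemma nth_le_of_count (s t : seq R) (e : R) (k : nat) :
  sorted <=%R s -> sorted <=%R t -> size s = size t ->
  (forall c, (count (<= c)%R t <= count (<= (c + e))%R s)%N) ->
  (k < size s)%N -> nth 0 s k <= nth 0 t k + e.
Proof.
move=> ss st est cnt ks; rewrite leNgt; apply/negP => lt_ts.
have tk : (count (<= (nth 0 t k + e))%R s <= k)%N.
  rewrite leqNgt; apply/negP => /(nth_count_le 0 ss).
  by rewrite leNgt lt_ts.
have : nth 0 t k < nth 0 t k; last by rewrite ltxx.
apply: nth_count_gt => //; rewrite -est ks andbT.
exact: leq_trans (cnt _) tk.
Qed.

End SortedSequences.

Section CharPoly.

Lemma char_poly_intertwine (F : fieldType) n (P A B : 'M[F]_n) :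
  P \in unitmx -> P *m A = B *m P -> char_poly A = char_poly B.
Proof.
move=> Pu PAB; pose P' := map_mx polyC P.
have dP : \det P' != 0.
  by rewrite det_map_mx polyC_eq0 -unitfE -unitmxE.
apply: (mulfI dP); rewrite -[RHS]mulrC /char_poly -!det_mulmx; congr (\det _).
rewrite /char_poly_mx mulmxBr mulmxBl scalar_mxC; congr (_ - _).
by rewrite -!map_mxM PAB.
Qed.

Lemma mulmx_regroup (F : pzRingType) m n p q r (u : 'M[F]_(m, n))
    (V : 'M[F]_(n, p)) (D : 'M[F]_p) (Q : 'M[F]_(p, q)) (W : 'M[F]_(q, r)) :
  u *m (V *m D *m Q) *m W = (u *m V) *m D *m (Q *m W).
Proof. by rewrite !mulmxA. Qed.

End CharPoly.

Section Hermitian.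
Context {R : realType}.
Implicit Types (n : nat).

Lemma eigenvalues_perm n (A : 'M[R[i]]_n) (D : 'I_n -> R[i]) :
  char_poly A = \prod_i ('X - (D i)%:P) ->
  perm_eq (eigenvalues A) [seq complex.Re (D i) | i <- enum 'I_n].
Proof.
move=> AD; rewrite /eigenvalues perm_sort.
rewrite (map_comp (@complex.Re R) D); apply: perm_map.
apply: prod_XsubC_eq; rewrite big_map big_enum -[RHS]AD.
case: closed_field_poly_normal => /= r rP; rewrite [RHS]rP.
by rewrite (monicP (char_poly_monic A)) scale1r.
Qed.

Lemma size_eigenvalues n (A : 'M[R[i]]_n) : size (eigenvalues A) = n.
Proof.
rewrite /eigenvalues size_sort size_map.
case: closed_field_poly_normal => /= r rP.
have := size_char_poly A.
by rewrite rP (monicP (char_poly_monic A)) scale1r size_prod_XsubC => -[].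
Qed.

Lemma sorted_eigenvalues n (A : 'M[R[i]]_n) : sorted <=%R (eigenvalues A).
Proof. by apply: sort_sorted; exact: le_total. Qed.

Lemma root_eigenvalues n (A : 'M[R[i]]_n) (x : R) :
  root (char_poly A) x%:C%C -> x \in eigenvalues A.
Proof.
rewrite /eigenvalues mem_sort; case: closed_field_poly_normal => /= r ->.
rewrite (monicP (char_poly_monic A)) scale1r root_prod_XsubC => xr.
by apply/mapP; exists x%:C%C.
Qed.

Definition qform n (A : 'M[R[i]]_n) (u : 'rV[R[i]]_n) : R :=
  complex.Re ((u *m A *m (map_mx Num.conj u)^T) 0 0).

Definition rvnormsq n (u : 'rV[R[i]]_n) : R := \sum_i normsq (u 0 i).

Lemma qform1 n (u : 'rV[R[i]]_n) : qform 1%:M u = rvnormsq u.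
Proof.
rewrite /qform mulmx1 mxE Re_sum; apply: eq_bigr => i _.
by rewrite !mxE mulrC -normsqE.
Qed.

Lemma qformE n (A : 'M[R[i]]_n) u :
  qform A u = complex.Re (\sum_i u 0 i * \sum_j A i j * (u 0 j)^*).
Proof.
rewrite /qform -mulmxA mxE; congr complex.Re; apply: eq_bigr => i _.
by rewrite mxE; congr (_ * _); apply: eq_bigr => j _; rewrite !mxE.
Qed.

(** The spectral theorem, in the coordinates in which it is used below: a
    unitary change of coordinates turns the form into a diagonal one. *)
Lemma hermitian_diagonalization n (A : 'M[R[i]]_n) : A \is hermsymmx ->
  exists (P : 'M[R[i]]_n) (d : 'I_n -> R),
  [/\ P \in unitmx,
      forall u, qform A u = \sum_i d i * normsq ((u *m P) 0 i),
      forall u, rvnormsq u = rvnormsq (u *m P)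
    & perm_eq (eigenvalues A) [seq d i | i <- enum 'I_n]].
Proof.
move=> hA; pose Q := spectralmx A; pose D := spectral_diag A.
have Qu : Q \is unitarymx by exact: spectral_unitarymx.
have Qunit : Q \in unitmx by exact: unitarymx_unit.
have AE : A = invmx Q *m diag_mx D *m Q.
  exact/orthomx_spectralP/hermitian_normalmx.
have Dreal := hermitian_spectral_diag_real hA.
have QV : invmx Q = map_mx Num.conj Q^T by rewrite invmx_unitary.
have diagform (u : 'rV[R[i]]_n) (E : 'rV[R[i]]_n) :
    (u *m (invmx Q *m diag_mx E *m Q) *m (map_mx Num.conj u)^T) 0 0 =
    \sum_i E 0 i * (normsq ((u *m invmx Q) 0 i))%:C%C.
  have -> : u *m (invmx Q *m diag_mx E *m Q) *m (map_mx Num.conj u)^T =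
      (u *m invmx Q) *m diag_mx E *m (map_mx Num.conj (u *m invmx Q))^T.
    rewrite mulmx_regroup map_mxM trmx_mul; congr (_ *m (_ *m _)); rewrite QV; apply/matrixP => i j.
    by rewrite !mxE /= conjCK.
  rewrite mul_mx_diag mxE; apply: eq_bigr => i _; rewrite !mxE normsqE.
  by ring.
exists (invmx Q), (fun i => complex.Re (D 0 i)); split.
- by rewrite unitmx_inv.
- move=> u; rewrite /qform {1}AE diagform Re_sum; apply: eq_bigr => i _.
  have /complex_realP[x ->] := mxOverP Dreal 0 i.
  by rewrite Re_realM.
- move=> u; rewrite -qform1 /qform.
  have {1}-> : 1%:M = invmx Q *m diag_mx (const_mx 1) *m Q :> 'M[R[i]]_n.
    by rewrite diag_const_mx mulmx1 mulVmx.
  by rewrite diagform Re_sum; apply: eq_bigr => i _; rewrite mxE mul1r.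
- apply: eigenvalues_perm.
  have <- : char_poly (diag_mx D) = char_poly A.
    apply/esym; apply: (char_poly_intertwine Qunit).
    by rewrite {1}AE -!mulmxA mulKVmx.
  rewrite char_poly_trig ?diag_mx_is_trig//.
  by apply: eq_bigr => i _; rewrite mxE eqxx.
Qed.

(** If there were more directions below [c] for [B] and above [c + h] for [A],
    counted together, than there are dimensions, the two spectral subspaces would
    meet, and a common nonzero vector would contradict the comparison of the
    forms. *)
Lemma count_eigenvalues_le n (A B : 'M[R[i]]_n) (h c : R) :
  A \is hermsymmx -> B \is hermsymmx ->
  (forall u, qform A u <= qform B u + h * rvnormsq u) ->
  (count (<= c)%R (eigenvalues B) <= count (<= (c + h))%R (eigenvalues A))%N.
Proof.
move=> hA hB AB.
have [P [d [Pu PE PN /permP/(_ (<= (c + h))%R) Pp]]] := hermitian_diagonalization hA.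
have [Q [e [Qu QE QN /permP/(_ (<= c)%R) Qp]]] := hermitian_diagonalization hB.
rewrite [X in (_ <= X)%N]Pp [X in (X <= _)%N]Qp (count_map d) (count_map e) leqNgt; apply/negP => lt_AB.
pose S := [pred i | d i <= c + h]; pose T := [pred i | c < e i].
have cS : #|S| = count (preim d (<= (c + h))%R) (enum 'I_n).
  rewrite -sum1_card -sum1_count big_enum_cond.
  by apply: eq_bigl => i; rewrite inE.
have cT : (n - #|T|)%N = count (preim e (<= c)%R) (enum 'I_n).
  have -> : (n - #|T|)%N = #|[predC T]|.
    by apply: (canLR (addKn _)); rewrite (cardC T) card_ord.
  rewrite -sum1_card -sum1_count big_enum_cond.
  by apply: eq_bigl => i; rewrite !inE leNgt.
rewrite -cS -cT in lt_AB.
(* u *m N = 0 says that u has no component along S for A, nor along T for B *)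
pose N := row_mx (colsub (enum_val : 'I_#|S| -> 'I_n) P)
                 (colsub (enum_val : 'I_#|T| -> 'I_n) Q).
have ltn : (\rank N < n)%N.
  apply: leq_ltn_trans (rank_leq_col N) _.
  by have := max_card (mem T); rewrite card_ord; lia.
have Nker : kermx N != 0 by rewrite kermx_eq0 /row_free ltn_eqF.
pose u := nz_row (kermx N).
have u0 : u != 0 by rewrite nz_row_eq0.
have : u *m N = 0 by apply/sub_kermxP; exact: nz_row_sub.
rewrite mul_mx_row => /eqP; rewrite row_mx_eq0 => /andP[/eqP uS /eqP uT].
have zS i : i \in S -> (u *m P) 0 i = 0.
  move=> iS; transitivity ((u *m colsub enum_val P) 0 (enum_rank_in iS i)).
    by rewrite !mxE; apply: eq_bigr => j _; rewrite !mxE enum_rankK_in.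
  by rewrite uS mxE.
have zT i : i \in T -> (u *m Q) 0 i = 0.
  move=> iT; transitivity ((u *m colsub enum_val Q) 0 (enum_rank_in iT i)).
    by rewrite !mxE; apply: eq_bigr => j _; rewrite !mxE enum_rankK_in.
  by rewrite uT mxE.
have qB : qform B u <= c * rvnormsq u.
  rewrite QE QN /rvnormsq mulr_sumr; apply: ler_sum => i _.
  have [iT|] := boolP (i \in T); first by rewrite zT// normsq0 !mulr0.
  by rewrite inE -leNgt => ec; rewrite ler_wpM2r// normsq_ge0.
have qA : (c + h) * rvnormsq u < qform A u.
  have : 0 < qform A u - (c + h) * rvnormsq u.
    rewrite PE {1}PN /rvnormsq mulr_sumr -sumrB.
    have [i ui] : exists i, (u *m P) 0 i != 0.
      apply/existsP; rewrite -negb_forall; apply: contra u0 => /forallP uP0.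
      rewrite -(mulmxK Pu u) (_ : u *m P = 0) ?mul0mx//.
      by apply/rowP => i; rewrite [RHS]mxE; apply/eqP.
    have nneg j : 0 <= d j * normsq ((u *m P) 0 j) - (c + h) * normsq ((u *m P) 0 j).
      have [jS|] := boolP (j \in S); first by rewrite zS// normsq0 !mulr0 subrr.
      by rewrite inE -ltNge => cd; rewrite -mulrBl mulr_ge0 ?normsq_ge0 ?subr_ge0 ?ltW.
    rewrite (bigD1 i)//= ltr_pwDl ?sumr_ge0//.
    have iS : i \notin S by apply: contra ui => /zS->.
    rewrite -mulrBl mulr_gt0//; first by rewrite subr_gt0 ltNge; move: iS; rewrite inE.
    by rewrite lt_def normsq_ge0 normsq_eq0 ui.
  by rewrite subr_gt0.
have : (c + h) * rvnormsq u < (c + h) * rvnormsq u; last by rewrite ltxx.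
apply: (lt_le_trans qA); apply: (le_trans (AB u)).
by rewrite mulrDl lerD2r.
Qed.

(** Weyl's monotonicity principle. *)
Lemma eigenvalues_le n (A B : 'M[R[i]]_n) (h : R) k :
  A \is hermsymmx -> B \is hermsymmx ->
  (forall u, qform A u <= qform B u + h * rvnormsq u) -> (k < n)%N ->
  nth 0 (eigenvalues A) k <= nth 0 (eigenvalues B) k + h.
Proof.
move=> hA hB AB kn.
apply: (@nth_le_of_count _ (eigenvalues A) (eigenvalues B) h k).
- exact: sorted_eigenvalues.
- exact: sorted_eigenvalues.
- exact: etrans (size_eigenvalues A) (esym (size_eigenvalues B)).
- by move=> c; exact: count_eigenvalues_le.
- by rewrite (size_eigenvalues A).
Qed.

Lemma sum_eigenvalues n (A : 'M[R[i]]_n) :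
  \sum_(k < n) nth 0 (eigenvalues A) k = complex.Re (\tr A).
Proof.
case: n A => [|n] A; first by rewrite big_ord0 /mxtrace big_ord0.
have -> : \sum_(k < n.+1) nth 0 (eigenvalues A) k = \sum_(x <- eigenvalues A) x.
  by rewrite [RHS](big_nth 0) (size_eigenvalues A) big_mkord.
rewrite /eigenvalues (perm_big _ (permEl (perm_sort _ _))) big_map -Re_sum.
have cp := char_poly_trace A (ltn0Sn n).
have sz := size_char_poly A.
case: closed_field_poly_normal => /= r rP.
rewrite rP (monicP (char_poly_monic A)) scale1r in cp sz *.
have sr : size r = n.+1 by move: sz; rewrite size_prod_XsubC => -[].
congr complex.Re; apply: oppr_inj; rewrite -cp -[n in RHS]/(n.+1.-1) -sr.
by rewrite coefPn_prod_XsubC// sr.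
Qed.

End Hermitian.

(** * Walks and gauge transformations *)

Section Walks.
Context {V E : Type} (G : multigraph V E).

Lemma tgt_inv e : tgt G (inv G e) = src G e.
Proof. by rewrite -src_inv Defs.invK. Qed.

Lemma walk_cat u p v q w :
  walk G u p v -> walk G v q w -> walk G u (p ++ q) w.
Proof.
elim: p u => [|e p IH] u /=; first by move=> ->.
by move=> [-> pv] qw; split=> //; exact: IH.
Qed.

Definition rev_walk (p : seq E) : seq E := rev (map (inv G) p).

Lemma walk_rev u p v : walk G u p v -> walk G v (rev_walk p) u.
Proof.
rewrite /rev_walk; elim: p u => [|e p IH] u /=; first by move=> ->.
move=> [<- /IH pv]; rewrite rev_cons -cats1; apply: walk_cat pv _ => /=.
by rewrite src_inv tgt_inv.
Qed.

Context {W : zmodType}.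

Lemma flux_cat (b : E -> W) p q : flux b (p ++ q) = flux b p + flux b q.
Proof. exact: big_cat. Qed.

Lemma flux_cons (b : E -> W) e p : flux b (e :: p) = b e + flux b p.
Proof. exact: big_cons. Qed.

Lemma flux_rev (b : E -> W) p :
  one_form G b -> flux b (rev_walk p) = - flux b p.
Proof.
move=> bG; rewrite /flux /rev_walk; elim: p => [|e p IH] /=.
  by rewrite !big_nil oppr0.
by rewrite rev_cons -cats1 big_cat IH big_seq1 big_cons bG opprD addrC.
Qed.

Lemma flux_exact (h : V -> W) u p v :
  walk G u p v -> flux (fun e => h (tgt G e) - h (src G e)) p = h v - h u.
Proof.
rewrite /flux; elim: p u => [|e p IH] u /=.
  by move=> ->; rewrite big_nil subrr.
by move=> [<- /IH pv]; rewrite big_cons pv addrC addrA subrK.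
Qed.

End Walks.

Section Gauge.
Context {R : realType} {V E : Type} (G : multigraph V E).

(** The potential is the flux of the difference of the two forms along a walk
    from a base point; equality of the fluxes through cycles says that it does
    not depend on the walk, modulo [2 pi]. *)
Lemma gauge_potential (v0 : V) (a b : E -> R) :
  connected_graph G -> one_form G a -> one_form G b ->
  (forall c, is_cycle G c ->
     exists k : int, flux a c = flux b c + 2 * pi * k%:~R) ->
  exists g : V -> R, forall e,
    expi (a e) = (expi (g (src G e)))^* * expi (b e) * expi (g (tgt G e)).
Proof.
move=> conG aG bG ab.
pose p v := sval (cid (conG v0 v)).
have pP v : walk G v0 (p v) v by rewrite /p; case: cid.
exists (fun v => flux a (p v) - flux b (p v)) => e.
pose c := p (src G e) ++ e :: rev_walk G (p (tgt G e)).
have cyc : is_cycle G c.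
  exists v0; apply: walk_cat (pP _) _; split=> //.
  exact/walk_rev/pP.
have [k] := ab _ cyc.
rewrite /c !flux_cat !flux_cons !flux_rev// => abk.
rewrite -expiN -!expiD -[RHS]mulr1 -(expi_2pi_int k) -expiD; congr expi.
by lra.
Qed.

End Gauge.

(** * Schrodinger operators on finite graphs *)

Section LinearOperators.
Context {R : realType} {V : finType}.
Implicit Types (L : (V -> R[i]) -> R[i]).

Definition lin_functional L :=
  forall f, L f = \sum_w f w * L (fun v => (v == w)%:R).

Lemma lin_eval x : lin_functional (fun f => f x).
Proof.
move=> f; rewrite (bigD1 x)//= eqxx mulr1 big1 ?addr0// => w.
by rewrite eq_sym => /negPf ->; rewrite mulr0.
Qed.

Lemma linZ c L : lin_functional L -> lin_functional (fun f => c * L f).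
Proof.
move=> LL f; rewrite LL mulr_sumr; apply: eq_bigr => w _.
by rewrite mulrCA.
Qed.

Lemma linB L L' : lin_functional L -> lin_functional L' ->
  lin_functional (fun f => L f - L' f).
Proof.
move=> LL LL' f; rewrite LL LL' -sumrB; apply: eq_bigr => w _.
by rewrite mulrBr.
Qed.

Lemma lin_sum (I : finType) (P : pred I) (F : I -> (V -> R[i]) -> R[i]) :
  (forall i, lin_functional (F i)) ->
  lin_functional (fun f => \sum_(i | P i) F i f).
Proof.
move=> FL f; under eq_bigr do rewrite FL.
by rewrite exchange_big; apply: eq_bigr => w _; rewrite mulr_sumr.
Qed.

Lemma operator_mxE (T : (V -> R[i]) -> V -> R[i]) (f : V -> R[i]) v :
  (forall x, lin_functional (T^~ x)) ->
  \sum_j operator_mx T (enum_rank v) j * f (enum_val j) = T f v.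
Proof.
move=> TL; rewrite [RHS]TL [RHS](reindex enum_val (onW_bij _ (enum_val_bij V))).
by apply: eq_bigr => j _; rewrite mxE enum_rankK mulrC.
Qed.

Definition of_rV (u : 'rV[R[i]]_#|V|) (v : V) : R[i] := (u 0 (enum_rank v))^*.

Lemma rvnormsq_of_rV u : rvnormsq u = \sum_v normsq (of_rV u v).
Proof.
rewrite /rvnormsq (reindex enum_rank (onW_bij _ (enum_rank_bij V))).
by apply: eq_bigr => v _; rewrite normsq_conj.
Qed.

Lemma qform_operator_mx (T : (V -> R[i]) -> V -> R[i]) u :
  (forall x, lin_functional (T^~ x)) ->
  qform (operator_mx T) u =
  complex.Re (\sum_v (of_rV u v)^* * T (of_rV u) v).
Proof.
move=> TL; rewrite qformE; congr complex.Re.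
rewrite (reindex enum_rank (onW_bij _ (enum_rank_bij V))).
apply: eq_bigr => v _; rewrite conjCK; congr (_ * _).
rewrite -operator_mxE//; apply: eq_bigr => j _.
by rewrite /of_rV enum_valK.
Qed.

End LinearOperators.

Section Operators.
Context {R : realType} {V E : finType} (G : multigraph V E).
Implicit Types (D : {set E}) (psi : E -> R) (q : V -> R) (f : V -> R[i]).

(** The fiber operators and the operators on subgraphs differ only by the edges
    that they use, their phases and their diagonal parts. *)
Definition hopping_operator D psi q f v : R[i] :=
  (q v)%:C%C * f v - \sum_(e in D | src G e == v) expi (psi e) * f (tgt G e).

Lemma hopping_lin D psi q x : lin_functional ((hopping_operator D psi q)^~ x).
Proof.
apply: linB; first by apply: linZ; exact: lin_eval.
by apply: lin_sum => e; apply: linZ; exact: lin_eval.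
Qed.

Lemma fiber_operatorE (d : nat) (m : E -> 'rV[R]_d) phi q theta :
  fiber_operator G m phi q theta =
  hopping_operator finset.setT (fun e => phi e + inner (m e) theta)
    (fun v => (degree G finset.setT v)%:R + q v).
Proof.
apply/funext => f; apply/funext => v; rewrite /fiber_operator /hopping_operator.
rewrite rmorphD rmorph_nat mulrDl addrAC; congr (_ - _).
by apply: eq_bigl => e; rewrite inE.
Qed.

Lemma finite_magnetic_schrodingerE D alpha q :
  finite_magnetic_schrodinger G D alpha q =
  hopping_operator D alpha (fun v => (degree G D v)%:R + q v).
Proof.
apply/funext => f; apply/funext => v.
rewrite /finite_magnetic_schrodinger /hopping_operator.
rewrite sumrB rmorphD rmorph_nat mulrDl addrAC; congr (_ + _ - _).
rewrite sumr_const mulr_natl; congr (_ *+ _).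
by apply: eq_card => e; rewrite !inE.
Qed.

Definition inv_closed D := forall e, (inv G e \in D) = (e \in D).

Lemma hopping_hermitian D psi q : inv_closed D -> one_form G psi ->
  operator_mx (hopping_operator D psi q) \is hermsymmx.
Proof.
move=> DG psiG; apply/is_hermitianmxP; rewrite expr0 scale1r.
apply/matrixP => i j; rewrite !mxE /hopping_operator.
rewrite /= rmorphB rmorphM rmorph_sum /= conj_real.
congr (_ - _).
  rewrite eq_sym rmorph_nat; have [->//|ne] := eqVneq (enum_val j) (enum_val i).
  by rewrite !mulr0.
rewrite big_mkcond [RHS]big_mkcond/= (reindex_inj (inv_inj (Defs.invK G)))/=.
apply: eq_bigr => e _.
rewrite DG src_inv tgt_inv psiG expiN.
rewrite rmorphM rmorph_nat; case: (e \in D) => //=.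
by do 2 case: eqP => _; rewrite ?(mulr0, mulr1).
Qed.

Definition hopping_form D psi f : R :=
  \sum_(e in D) complex.Re ((f (src G e))^* * (expi (psi e) * f (tgt G e))).

Lemma sum_src D (F : E -> V -> R) :
  \sum_v \sum_(e in D | src G e == v) F e v = \sum_(e in D) F e (src G e).
Proof.
rewrite (partition_big (src G) xpredT)//=.
by apply: eq_bigr => v _; apply: eq_bigr => e /andP[_ /eqP <-].
Qed.

Lemma qform_hopping D psi q u :
  qform (operator_mx (hopping_operator D psi q)) u =
  \sum_v q v * normsq (of_rV u v) - hopping_form D psi (of_rV u).
Proof.
rewrite qform_operator_mx; last by move=> x; exact: hopping_lin.
set f := of_rV u; rewrite Re_sum /hopping_form.
rewrite -(sum_src D (fun e v =>
  complex.Re ((f v)^* * (expi (psi e) * f (tgt G e))))) -sumrB.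
apply: eq_bigr => v _; rewrite /hopping_operator mulrBr ReD ReN; congr (_ - _).
  by rewrite mulrCA -normsqE Re_realM.
by rewrite mulr_sumr Re_sum.
Qed.

Lemma sum_degree D (F : V -> R) :
  \sum_(e in D) F (src G e) = \sum_v (degree G D v)%:R * F v.
Proof.
rewrite -(sum_src D (fun _ v => F v)); apply: eq_bigr => v _.
rewrite sumr_const mulr_natl; congr (_ *+ _).
by apply: eq_card => e; rewrite !inE.
Qed.

(** An oriented edge contributes at most half the squares at its two ends, and
    both ends run over the oriented edges. *)
Lemma hopping_form_le D psi f : inv_closed D ->
  `|hopping_form D psi f| <= \sum_v (degree G D v)%:R * normsq (f v).
Proof.
move=> DG; set N := \sum_v _.
have N1 : N = \sum_(e in D) normsq (f (src G e)).
  by rewrite (sum_degree D (fun v => normsq (f v))).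
have N2 : N = \sum_(e in D) normsq (f (tgt G e)).
  rewrite N1 (reindex_inj (inv_inj (Defs.invK G)))/=.
  by apply: eq_big => [e|e _]; rewrite ?DG ?src_inv.
have -> : N = \sum_(e in D) ((normsq (f (src G e)) + normsq (f (tgt G e))) / 2).
  by rewrite -mulr_suml big_split -N1 -N2 /=; lra.
apply: le_trans (ler_norm_sum _ _ _) _; apply: ler_sum => e _.
set a := f (src G e); set b := f (tgt G e).
have nb : normsq (expi (psi e) * b) = normsq b.
  by rewrite normsqM normsq_expi mul1r.
have h1 := normsqD a (expi (psi e) * b).
have h2 := normsqD a (- (expi (psi e) * b)).
have p1 := normsq_ge0 (a + expi (psi e) * b).
have p2 := normsq_ge0 (a - expi (psi e) * b).
rewrite normsqN mulrN ReN nb in h2; rewrite nb in h1.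
by rewrite ler_norml; apply/andP; split; lra.
Qed.

Lemma hopping_trace D psi q q' :
  complex.Re (\tr (operator_mx (hopping_operator D psi (fun v => q v + q' v)))) =
  complex.Re (\tr (operator_mx (hopping_operator D psi q))) + \sum_v q' v.
Proof.
rewrite /mxtrace !Re_sum.
rewrite (reindex enum_rank (onW_bij _ (enum_rank_bij V))).
rewrite [X in _ = X + _](reindex enum_rank (onW_bij _ (enum_rank_bij V))).
rewrite -big_split; apply: eq_bigr => v _ /=.
rewrite !mxE !enum_rankK /hopping_operator eqxx !mulr1 !ReD /=.
by rewrite addrAC.
Qed.

(** A gauge transformation conjugates the operators by a diagonal unitary. *)
Lemma hopping_char_poly (v0 : V) D (a b : E -> R) q :
  connected_graph G -> one_form G a -> one_form G b ->
  (forall c, is_cycle G c ->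
     exists k : int, flux a c = flux b c + 2 * pi * k%:~R) ->
  char_poly (operator_mx (hopping_operator D a q)) =
  char_poly (operator_mx (hopping_operator D b q)).
Proof.
move=> conG aG bG ab; have [g gP] := gauge_potential v0 conG aG bG ab.
pose P := diag_mx (\row_(i < #|V|) expi (g (enum_val i))).
apply: (@char_poly_intertwine _ _ P).
  rewrite unitmxE det_diag unitfE; apply/prodf_neq0 => i _.
  by rewrite mxE expi_neq0.
apply/matrixP => i j; rewrite mul_diag_mx mul_mx_diag !mxE /hopping_operator.
rewrite mulrBr mulrBl mulr_sumr mulr_suml; congr (_ - _).
  rewrite mulrCA -mulrA; congr (_ * _).
  by have [->|] := eqVneq; rewrite ?(mulr0, mul0r, mulr1, mul1r).
apply: eq_bigr => e /andP[_ /eqP <-]; rewrite gP !mulrA.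
rewrite [expi (g _) * _]mulrC expi_conjM mul1r -!mulrA; congr (_ * _).
by have [->|] := eqVneq; rewrite ?(mulr0, mul0r, mulr1, mul1r).
Qed.

End Operators.

(** * Band edges *)

Lemma eq_eigenvalues (R : realType) n (A B : 'M[R[i]]_n) :
  char_poly A = char_poly B -> eigenvalues A = eigenvalues B.
Proof. by rewrite /eigenvalues => ->. Qed.

Section FiberBounds.
Context {R : realType} {d : nat} {V E : finType} (G : multigraph V E).
Implicit Types (m : E -> 'rV[R]_d) (theta : 'rV[R]_d).

Lemma innerN (x theta : 'rV[R]_d) : inner (- x) theta = - inner x theta.
Proof. by rewrite /inner -sumrN; apply: eq_bigr => s _; rewrite mxE mulNr. Qed.

Lemma innerD (x y theta : 'rV[R]_d) :
  inner (x + y) theta = inner x theta + inner y theta.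
Proof.
by rewrite /inner -big_split; apply: eq_bigr => s _; rewrite mxE mulrDl.
Qed.

Lemma inner0 theta : inner 0 theta = 0.
Proof. by rewrite /inner big1// => s _; rewrite mxE mul0r. Qed.

Lemma flux_inner m (phi : E -> R) theta c :
  flux (fun e => phi e + inner (m e) theta) c =
  flux phi c + inner (flux m c) theta.
Proof.
rewrite /flux big_split; congr (_ + _); symmetry.
exact: (big_morph _ (fun x y => innerD x y theta) (inner0 theta)).
Qed.

Lemma fiber_form m (phi : E -> R) theta : one_form G m -> one_form G phi ->
  one_form G (fun e => phi e + inner (m e) theta).
Proof. by move=> mG phiG e; rewrite mG phiG innerN opprD. Qed.

Lemma inv_closedT : inv_closed G finset.setT.
Proof. by move=> e; rewrite !inE. Qed.

Lemma inv_closed_supp m : one_form G m -> inv_closed G (supp m).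
Proof. by move=> mG e; rewrite !inE mG oppr_eq0. Qed.

Lemma inv_closedC (D : {set E}) : inv_closed G D -> inv_closed G (finset.setC D).
Proof. by move=> DG e; rewrite !inE DG. Qed.

Lemma degreeID (D : {set E}) v :
  degree G finset.setT v = (degree G D v + degree G (finset.setC D) v)%N.
Proof.
rewrite /degree -(finset.cardsID D); congr (_ + _)%N; apply: eq_card => e.
  by rewrite !inE andbC.
by rewrite !inE.
Qed.

Lemma degree_sum (D : {set E}) : (\sum_v degree G D v)%N = #|D|.
Proof.
rewrite -sum1_card (partition_big (src G) xpredT)//=; apply: eq_bigr => v _.
by rewrite sum1dep_card; apply: eq_card => e; rewrite !inE.
Qed.

Variables (alpha : E -> R) (Q : V -> R) (m : E -> 'rV[R]_d).
Hypotheses (alphaG : one_form G alpha) (mG : one_form G m).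

Let H0 := operator_mx (finite_magnetic_schrodinger G (finset.setC (supp m)) alpha Q).
Let H theta := operator_mx (fiber_operator G m alpha Q theta).

Lemma subgraph_hermitian : H0 \is hermsymmx.
Proof.
rewrite /H0 finite_magnetic_schrodingerE; apply: hopping_hermitian => //.
exact/inv_closedC/inv_closed_supp.
Qed.

Lemma fiber_hermitian theta : H theta \is hermsymmx.
Proof.
rewrite /H fiber_operatorE; apply: hopping_hermitian; first exact: inv_closedT.
exact: fiber_form.
Qed.

(** The phases depend on [theta] only on the support of [m]; so the fiber
    operator exceeds the operator of the complementary subgraph by the
    Laplacian of the support. *)
Lemma qform_fiber theta u : qform (H theta) u = qform H0 u +
  (\sum_v (degree G (supp m) v)%:R * normsq (of_rV u v) -
   hopping_form G (supp m) (fun e => alpha e + inner (m e) theta) (of_rV u)).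
Proof.
rewrite /H /H0 fiber_operatorE finite_magnetic_schrodingerE !qform_hopping.
rewrite addrACA -opprD; congr (_ - _).
  rewrite -big_split; apply: eq_bigr => v _ /=.
  by rewrite (degreeID (supp m)) natrD; ring.
rewrite /hopping_form (bigID (mem (supp m)))/= addrC; congr (_ + _).
  apply: eq_big => e; first by rewrite !inE.
  rewrite finset.in_setT/= inE negbK => /eqP ->.
  by rewrite inner0 addr0.
by apply: eq_bigl => e; rewrite !inE.
Qed.

Lemma qform_fiber_ge theta u : qform H0 u <= qform (H theta) u.
Proof.
rewrite qform_fiber lerDl subr_ge0.
apply: le_trans (ler_norm _) _.
exact/hopping_form_le/inv_closed_supp.
Qed.

Lemma qform_fiber_le theta u : qform (H theta) u <= qform H0 u +
  2 * \sum_v (degree G (supp m) v)%:R * normsq (of_rV u v).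
Proof.
rewrite qform_fiber.
have := hopping_form_le (fun e => alpha e + inner (m e) theta) (of_rV u)
  (inv_closed_supp mG).
by rewrite ler_norml => /andP[]; lra.
Qed.

Lemma fiber_eigenvalue_ge theta k : (k < #|V|)%N ->
  nth 0 (eigenvalues H0) k <= nth 0 (eigenvalues (H theta)) k.
Proof.
move=> kV; rewrite -[leRHS]addr0; apply: eigenvalues_le => //.
- exact: subgraph_hermitian.
- exact: fiber_hermitian.
- by move=> u; rewrite mul0r addr0; exact: qform_fiber_ge.
Qed.

Lemma fiber_eigenvalue_le theta k : (k < #|V|)%N ->
  nth 0 (eigenvalues (H theta)) k <=
  nth 0 (eigenvalues H0) k + 2 * (\max_v degree G (supp m) v)%N%:R.
Proof.
move=> kV; apply: eigenvalues_le => //.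
- exact: fiber_hermitian.
- exact: subgraph_hermitian.
move=> u; apply: le_trans (qform_fiber_le theta u) _.
rewrite lerD2l -mulrA ler_pM2l// rvnormsq_of_rV mulr_sumr.
apply: ler_sum => v _; rewrite ler_wpM2r ?normsq_ge0// ler_nat.
exact: (leq_bigmax v).
Qed.

(** The upper edges of all bands are controlled at once by one operator, whose
    trace exceeds that of the lower one by twice the number of oriented edges
    in the support. *)
Lemma fiber_total_width : exists b : nat -> R,
  (forall theta k, (k < #|V|)%N -> nth 0 (eigenvalues (H theta)) k <= b k) /\
  \sum_(k < #|V|) (b k - nth 0 (eigenvalues H0) k) = 2 * #|supp m|%:R.
Proof.
pose H1 := operator_mx (hopping_operator G (finset.setC (supp m)) alpha
  (fun v => (degree G (finset.setC (supp m)) v)%:R + Q v +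
            2 * (degree G (supp m) v)%:R)).
exists (nth 0 (eigenvalues H1)); split.
  move=> theta k kV; rewrite -[leRHS]addr0; apply: eigenvalues_le => //.
  - exact: fiber_hermitian.
  - apply: hopping_hermitian => //.
    exact/inv_closedC/inv_closed_supp.
  move=> u; rewrite mul0r addr0; apply: le_trans (qform_fiber_le theta u) _.
  rewrite /H0 finite_magnetic_schrodingerE !qform_hopping addrAC lerD2r.
  rewrite mulr_sumr -big_split; apply: ler_sum => v _ /=.
  by rewrite [leRHS]mulrDl mulrA.
rewrite sumrB [X in X - _](sum_eigenvalues H1) [X in _ - X](sum_eigenvalues H0).
rewrite hopping_trace.
rewrite /H0 finite_magnetic_schrodingerE addrAC subrr add0r.
by rewrite -mulr_sumr -natr_sum degree_sum.
Qed.

End FiberBounds.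

(** * Periodic graphs and their bands *)

(** The Lebesgue measure is defined on all sets, as an outer measure; bands and
    spectra are measured through the two properties below. *)
Section OuterMeasure.
Context {R : realType}.

Lemma lebesgue_measure_le (A B : set R) :
  A `<=` B -> (lebesgue_measure A <= lebesgue_measure B)%E.
Proof. by move=> AB; exact: (@le_mu_ext _ (ocitv_type R) R (wlength idfun)). Qed.

Lemma lebesgue_measure_bigsetU n (F : nat -> set R) :
  (lebesgue_measure (\big[setU/set0]_(i < n) F i)
   <= \sum_(i < n) lebesgue_measure (F i))%E.
Proof.
rewrite /lebesgue_measure /lebesgue_stieltjes_measure /measure_extension /=.
apply: outer_measure_subadditive.
Qed.

End OuterMeasure.

Section PeriodicGraphs.
Context {R : realType} {d : nat} (G : periodic_graph R d).
Implicit Types (m : qedge G -> 'rV[R]_d) (phi : qedge G -> R).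

Lemma tgt_eproj e : tgt (qgraph G) (eproj e) = vproj (tgt (graph G) e).
Proof. by rewrite -src_inv inv_eproj src_eproj src_inv. Qed.

Lemma tgt_eshift k (e : edge G) :
  tgt (graph G) (eshift k e) = vshift k (tgt (graph G) e).
Proof. by rewrite -src_inv inv_eshift src_eshift src_inv. Qed.

Lemma walk_proj u p v : walk (graph G) u p v ->
  walk (qgraph G) (vproj u) (map (@eproj _ _ G) p) (vproj v).
Proof.
elim: p u => [|e p IH] u /=; first by move=> ->.
by move=> [<- /IH]; rewrite src_eproj tgt_eproj.
Qed.

Lemma qgraph_connected : connected_graph (qgraph G).
Proof.
move=> u v; have [u' <-] := vproj_surj u; have [v' <-] := vproj_surj v.
have [p pP] := graph_connected u' v'.
by exists (map (@eproj _ _ G) p); exact: walk_proj.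
Qed.

Lemma some_vertex : exists v : vert G, True.
Proof.
apply: contrapT => no; apply: (@graph_infinite _ _ G).
rewrite (_ : setT = set0)//; apply/seteqP; split=> // v _.
by case: no; exists v.
Qed.

Lemma einduced_form (alpha : edge G -> R) : magnetic_potential alpha ->
  one_form (qgraph G) (einduced alpha).
Proof.
move=> [aG aP] f; have [e <-] := eproj_surj f.
by rewrite inv_eproj !einducedE.
Qed.

(** The bands do not depend on the forms, since the phases of two choices have
    the same fluxes modulo [2 pi]. *)
Lemma fiber_eigenvalues_gauge (alpha : edge G -> R) (Q : qvert G -> R)
    m0 phi m theta :
  magnetic_potential alpha ->
  same_flux (qgraph G) (coordinate_form (G := G)) m0 ->
  same_flux_mod2pi (qgraph G) (einduced alpha) phi ->
  same_flux (qgraph G) (coordinate_form (G := G)) m ->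
  char_poly (operator_mx (fiber_operator (qgraph G) m0 phi Q theta)) =
  char_poly (operator_mx (fiber_operator (qgraph G) m (einduced alpha) Q theta)).
Proof.
move=> aG [m0G m0P] [phiG phiP] [mG mP]; rewrite !fiber_operatorE.
have [v0 _] := some_vertex.
apply: (hopping_char_poly (vproj v0)) => //.
- exact: qgraph_connected.
- exact: fiber_form.
- by apply: fiber_form => //; exact: einduced_form.
move=> c cc; have [k phik] := phiP c cc; exists k.
by rewrite !flux_inner m0P// mP// phik addrAC.
Qed.

Variables (alpha : edge G -> R) (Q : vert G -> R) (m0 : qedge G -> 'rV[R]_d)
  (phi : qedge G -> R) (m : qedge G -> 'rV[R]_d).
Hypotheses (alphaP : magnetic_potential alpha)
  (m0P : same_flux (qgraph G) (coordinate_form (G := G)) m0)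
  (phiP : same_flux_mod2pi (qgraph G) (einduced alpha) phi)
  (mP : same_flux (qgraph G) (coordinate_form (G := G)) m).

Lemma band_functionE n theta : band_function m0 phi Q n theta =
  nth 0 (eigenvalues (operator_mx
    (fiber_operator (qgraph G) m (einduced alpha) (vinduced Q) theta))) n.
Proof.
exact: (congr1 (fun s : seq R => nth 0 s n)
  (eq_eigenvalues (fiber_eigenvalues_gauge _ _ alphaP m0P phiP mP))).
Qed.

Lemma band_itv (n : 'I_#|qvert G|) : band m0 phi Q n `<=`
  `[unperturbed_eigenvalue m alpha Q n,
    unperturbed_eigenvalue m alpha Q n + 2 * (max_degree m)%:R].
Proof.
move=> _ [theta _ <-]; rewrite /= in_itv /= band_functionE.
apply/andP; split; first exact: (fiber_eigenvalue_ge _ (einduced_form alphaP) mP.1).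
exact: (fiber_eigenvalue_le _ (einduced_form alphaP) mP.1).
Qed.

Lemma sum_bands_le :
  (\sum_(n < #|qvert G|) lebesgue_measure (band m0 phi Q n)
     <= (4 * invariant_I m)%:E)%E.
Proof.
have [b [bP bsum]] :=
  fiber_total_width (vinduced Q) (einduced_form alphaP) mP.1.
pose a n := unperturbed_eigenvalue m alpha Q n.
have le_ab (n : 'I_#|qvert G|) : a n <= b n.
  apply: le_trans (bP 0 n (ltn_ord n)).
  exact: (fiber_eigenvalue_ge _ (einduced_form alphaP) mP.1).
have -> : 4 * invariant_I m = \sum_(n < #|qvert G|) (b n - a n).
  by rewrite [RHS]bsum /invariant_I; lra.
rewrite -sumEFin; apply: lee_sum => n _.
have -> : (b n - a n)%:E = lebesgue_measure (`[a n, b n] : set R).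
  by rewrite lebesgue_measure_itv /= lte_fin; case: ltgtP (le_ab n) => //= ->;
    rewrite subrr.
apply: lebesgue_measure_le => _ [theta _ <-]; rewrite /= in_itv /= band_functionE.
apply/andP; split; first exact: (fiber_eigenvalue_ge _ (einduced_form alphaP) mP.1).
exact: bP.
Qed.

End PeriodicGraphs.

(** * Inverting a local operator on square-summable functions *)

Section ComplexSequences.
Context {R : realType}.
Implicit Types (z w : nat -> R[i]) (l : R[i]).

Definition ccvg z l :=
  ((fun n => complex.Re (z n)) @ \oo --> complex.Re l) /\
  ((fun n => complex.Im (z n)) @ \oo --> complex.Im l).

Definition clim z : R[i] :=
  (limn (fun n => complex.Re (z n)) +i* limn (fun n => complex.Im (z n)))%C.

Lemma ccvg_unique z l l' : ccvg z l -> ccvg z l' -> l = l'.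
Proof.
move=> [a b] [a' b']; rewrite (complex_split l) (complex_split l').
by congr (_ +i* _)%C; [apply: cvg_unique a a' | apply: cvg_unique b b'].
Qed.

Lemma ccvg_cst l : ccvg (fun=> l) l.
Proof. by split; exact: cvg_cst. Qed.

Lemma ccvgD z w l l' : ccvg z l -> ccvg w l' ->
  ccvg (fun n => z n + w n) (l + l').
Proof.
move=> [a b] [a' b']; split.
  by rewrite ReD; under eq_fun do rewrite ReD; exact: cvgD.
by rewrite ImD; under eq_fun do rewrite ImD; exact: cvgD.
Qed.

Lemma ccvgM z w l l' : ccvg z l -> ccvg w l' ->
  ccvg (fun n => z n * w n) (l * l').
Proof.
move=> [a b] [a' b']; split.
  by rewrite ReM; under eq_fun do rewrite ReM; apply: cvgB; exact: cvgM.
by rewrite ImM; under eq_fun do rewrite ImM; apply: cvgD; exact: cvgM.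
Qed.

Lemma ccvg_sum (I : Type) (r : seq I) (z : I -> nat -> R[i]) (l : I -> R[i]) :
  (forall i, ccvg (z i) (l i)) ->
  ccvg (fun n => \sum_(i <- r) z i n) (\sum_(i <- r) l i).
Proof.
move=> zl; elim: r => [|i r IH].
  by under eq_fun do rewrite big_nil; rewrite big_nil; exact: ccvg_cst.
by under eq_fun do rewrite big_cons; rewrite big_cons; exact: ccvgD.
Qed.

Lemma sum_normsq_cvg (I : Type) (r : seq I) (z : I -> nat -> R[i]) (l : I -> R[i]) :
  (forall i, ccvg (z i) (l i)) ->
  (fun n => \sum_(i <- r) normsq (z i n)) @ \oo --> \sum_(i <- r) normsq (l i).
Proof.
move=> zl; elim: r => [|i r IH].
  by under eq_fun do rewrite big_nil; rewrite big_nil; exact: cvg_cst.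
under eq_fun do rewrite big_cons; rewrite big_cons; apply: cvgD => //.
have [a b] := zl i; rewrite /normsq.
by apply: cvgD; rewrite !expr2; under eq_fun do rewrite expr2; exact: cvgM.
Qed.

Lemma sqr_geometric_bound (u : nat -> R) (q D : R) : 0 <= q < 1 -> 0 <= D ->
  (forall n, u n ^+ 2 <= q ^+ n * D) ->
  (forall n, `|u n| <= geometric (Num.sqrt D) (Num.sqrt q) n) /\
  `|Num.sqrt q| < 1.
Proof.
move=> /andP[q0 q1] D0 uD; split.
  move=> n; rewrite /geometric /= -sqrtr_sqr.
  have -> : Num.sqrt D * Num.sqrt q ^+ n = Num.sqrt (q ^+ n * D).
    rewrite mulrC sqrtrM ?exprn_ge0//; congr (_ * _).
    elim: n => [|n IH]; first by rewrite !expr0 sqrtr1.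
    by rewrite !exprS sqrtrM// IH.
  exact: ler_wsqrtr.
by rewrite ger0_norm ?sqrtr_ge0// -sqrtr1 ltr_sqrt.
Qed.

Lemma geometric_cvg0 (u : nat -> R) (q D : R) : 0 <= q < 1 -> 0 <= D ->
  (forall n, u n ^+ 2 <= q ^+ n * D) -> u @ \oo --> 0.
Proof.
move=> q01 D0 uD.
have [ug s1] := sqr_geometric_bound q01 D0 uD.
apply: norm_cvg0; apply: (squeeze_cvgr _ (cvg_cst 0) (cvg_geometric (Num.sqrt D) s1)).
by near=> n; rewrite normr_ge0 ug.
Unshelve. all: by end_near. Qed.

Lemma geometric_series_cvg (u : nat -> R) (q D : R) : 0 <= q < 1 -> 0 <= D ->
  (forall n, u n ^+ 2 <= q ^+ n * D) -> cvgn (series u).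
Proof.
move=> q01 D0 uD.
have [ug s1] := sqr_geometric_bound q01 D0 uD.
apply: normed_cvg; apply: (series_le_cvg _ _ ug).
- by move=> n.
- by move=> n; apply: le_trans (ug n).
exact: is_cvg_geometric_series.
Qed.

Lemma ccvg_geometric0 z q D : 0 <= q < 1 -> 0 <= D ->
  (forall n, normsq (z n) <= q ^+ n * D) -> ccvg z 0.
Proof.
move=> q01 D0 zD; split; apply: (geometric_cvg0 q01 D0) => n;
  apply: le_trans (zD n); [exact: Re_sqr_le_normsq|exact: Im_sqr_le_normsq].
Qed.

Lemma ccvg_geometric_series z q D : 0 <= q < 1 -> 0 <= D ->
  (forall n, normsq (z n) <= q ^+ n * D) ->
  ccvg (fun n => \sum_(k < n) z k) (clim (fun n => \sum_(k < n) z k)).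
Proof.
move=> q01 D0 zD; split => /=.
  have -> : (fun n => complex.Re (\sum_(k < n) z k)) =
      series (fun k => complex.Re (z k)).
    by apply/funext => n; rewrite Re_sum /series/= big_mkord.
  apply: (geometric_series_cvg q01 D0) => n.
  by apply: le_trans (zD n); exact: Re_sqr_le_normsq.
have -> : (fun n => complex.Im (\sum_(k < n) z k)) =
    series (fun k => complex.Im (z k)).
  by apply/funext => n; rewrite Im_sum /series/= big_mkord.
apply: (geometric_series_cvg q01 D0) => n.
by apply: le_trans (zD n); exact: Im_sqr_le_normsq.
Qed.

End ComplexSequences.

Section Ell2Norm.
Context {R : realType} {V : choiceType}.
Implicit Types (f g : V -> R[i]) (M : R) (s : seq V).

Definition sumsq s f : R := \sum_(v <- s) normsq (f v).

Definition ell2_le f M := forall s, uniq s -> sumsq s f <= M.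

Definition supported s f := forall v, v \notin s -> f v = 0.

Lemma ell2_le_ge0 f M : ell2_le f M -> 0 <= M.
Proof. by move=> /(_ [::] erefl); rewrite /sumsq big_nil. Qed.

Lemma ell2_le_normsq f M v : ell2_le f M -> normsq (f v) <= M.
Proof. by move=> /(_ [:: v] erefl); rewrite /sumsq big_seq1. Qed.

Lemma supported_ell2_le s f : supported s f -> uniq s -> ell2_le f (sumsq s f).
Proof.
move=> sf us t ut.
rewrite /sumsq (bigID (mem s))/= [X in _ + X]big1 ?addr0; last first.
  by move=> v vs; rewrite sf// normsq0.
rewrite -big_filter (perm_big [seq x <- s | x \in t]); last first.
  apply: uniq_perm; rewrite ?filter_uniq// => x.
  by rewrite !mem_filter andbC.
rewrite big_filter [leRHS](bigID (mem t))/= lerDl.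
by apply: sumr_ge0 => v _; exact: normsq_ge0.
Qed.

Lemma sumsq_eq s t f : supported s f -> supported t f -> uniq s -> uniq t ->
  sumsq s f = sumsq t f.
Proof.
move=> sf tf us ut; apply/le_anti/andP; split;
  exact: supported_ell2_le.
Qed.

Lemma ell2_normsqP f M : ell2_le f M <-> (ell2_normsq f <= M%:E)%E.
Proof.
split=> [fM|].
  apply: ge_ereal_sup => _ [A [finA _] <-].
  rewrite fsbig_finite// sumEFin lee_fin; exact/fM/finmap.fset_uniq.
move=> fM s us; rewrite -lee_fin; apply: le_trans fM.
apply: esum_ge; exists [set` s]; first by split=> //; exact: finite_seq.
by rewrite -fsbig_seq// sumEFin.
Qed.

Lemma ell2P f : ell2 f <-> exists M, ell2_le f M.
Proof.
split=> [|[M /ell2_normsqP fM]]; last by apply: le_lt_trans fM _; rewrite ltry.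
rewrite /ell2 => fin; exists (fine (ell2_normsq f)); apply/ell2_normsqP.
rewrite fineK// ge0_fin_numE//.
by apply: esum_ge0 => v _; rewrite lee_fin normsq_ge0.
Qed.

Lemma ell2_normsq_fine f : ell2 f -> exists2 M, ell2_le f M & ell2_normsq f = M%:E.
Proof.
move=> fin; have ge0 : (0 <= ell2_normsq f)%E.
  by apply: esum_ge0 => v _; rewrite lee_fin normsq_ge0.
have fE : ell2_normsq f = (fine (ell2_normsq f))%:E by rewrite fineK// ge0_fin_numE.
by exists (fine (ell2_normsq f)) => //; apply/ell2_normsqP; rewrite -fE.
Qed.

(** For small [t] the square of [w] is hardly enlarged, at the cost of a large
    multiple of the square of [z]. *)
Lemma normsqD_weighted (z w : R[i]) (t : R) : 0 < t ->
  normsq (z + w) <= (1 + t^-1) * normsq z + (1 + t) * normsq w.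
Proof.
move=> t0; rewrite -subr_ge0.
have -> : (1 + t^-1) * normsq z + (1 + t) * normsq w - normsq (z + w) =
    t^-1 * normsq (z - t%:C%C * w).
  by rewrite /normsq !(ReD, ImD, ReN, ImN, ReM, ImM)/=; field; rewrite gt_eqF.
by rewrite mulr_ge0 ?normsq_ge0// invr_ge0 ltW.
Qed.

Lemma ell2_leD f g M N (t : R) : 0 < t -> ell2_le f M -> ell2_le g N ->
  ell2_le (fun v => f v + g v) ((1 + t^-1) * M + (1 + t) * N).
Proof.
move=> t0 fM gN s us.
apply: (@le_trans _ _ ((1 + t^-1) * sumsq s f + (1 + t) * sumsq s g)).
  rewrite /sumsq !mulr_sumr -big_split; apply: ler_sum => v _.
  exact: normsqD_weighted.
by apply: lerD; rewrite ler_wpM2l ?fM ?gN// addr_ge0// ?invr_ge0 ltW.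
Qed.

Lemma ell2_leZ f M (c : R) : ell2_le f M ->
  ell2_le (fun v => c%:C%C * f v) (c ^+ 2 * M).
Proof.
move=> fM s us; rewrite /sumsq.
under eq_bigr do rewrite normsqM normsq_real.
by rewrite -mulr_sumr ler_wpM2l ?sqr_ge0// fM.
Qed.

End Ell2Norm.

Section LocalOperators.
Context {R : realType} {V : choiceType}.
Implicit Types (f g : V -> R[i]) (A B : (V -> R[i]) -> V -> R[i]).

(** A matrix with finite rows, the list [r] being a row. *)
Definition local_operator A := forall v, exists r : seq (R[i] * V),
  forall f, A f v = \sum_(p <- r) p.1 * f p.2.

Lemma local_ext A v : local_operator A -> exists w : seq V,
  forall f g, (forall u, u \in w -> f u = g u) -> A f v = A g v.
Proof.
move=> /(_ v)[r rP]; exists (map snd r) => f g fg; rewrite rP [RHS]rP.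
by apply: eq_big_seq => p pr; rewrite fg// map_f.
Qed.

Lemma local_sum A (I : Type) (r : seq I) (f : I -> V -> R[i]) v :
  local_operator A ->
  A (fun u => \sum_(i <- r) f i u) v = \sum_(i <- r) A (f i) v.
Proof.
move=> /(_ v)[w wP]; rewrite wP.
under eq_bigr do rewrite mulr_sumr.
by rewrite exchange_big; apply: eq_bigr => i _ /=; rewrite wP.
Qed.

Lemma localZ A c f v : local_operator A ->
  A (fun u => c * f u) v = c * A f v.
Proof.
move=> /(_ v)[r rP]; rewrite rP (rP f) mulr_sumr.
by apply: eq_bigr => p _; rewrite mulrCA.
Qed.

Lemma localB A f g v : local_operator A ->
  A (fun u => f u - g u) v = A f v - A g v.
Proof.
move=> /(_ v)[r rP]; rewrite rP (rP f) (rP g) -sumrB.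
by apply: eq_bigr => p _; rewrite mulrBr.
Qed.

Lemma local_cvg A (f : nat -> V -> R[i]) g v : local_operator A ->
  (forall u, ccvg (f^~ u) (g u)) -> ccvg (fun n => A (f n) v) (A g v).
Proof.
move=> /(_ v)[r rP] fg; rewrite rP; under eq_fun do rewrite rP.
by apply: ccvg_sum => p; apply: ccvgM => //; exact: ccvg_cst.
Qed.

Lemma local_comp A B : local_operator A -> local_operator B ->
  local_operator (fun f => A (B f)).
Proof.
move=> locA locB v; have [r rP] := locA v.
pose b u := sval (cid (locB u)).
have bP u f : B f u = \sum_(p <- b u) p.1 * f p.2 by rewrite /b; case: cid.
exists (flatten [seq [seq (p.1 * p'.1, p'.2) | p' <- b p.2] | p <- r]) => f.
rewrite rP big_flatten big_map; apply: eq_bigr => p _.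
by rewrite bP mulr_sumr big_map; apply: eq_bigr => p' _ /=; rewrite mulrA.
Qed.

Lemma local_subZ A c : local_operator A ->
  local_operator (fun f v => f v - c * A f v).
Proof.
move=> locA v; have [r rP] := locA v.
exists ((1, v) :: [seq (- c * p.1, p.2) | p <- r]) => f.
rewrite big_cons mul1r big_map rP mulr_sumr -sumrN; congr (_ + _).
by apply: eq_bigr => p _ /=; ring.
Qed.

(** Locality extends a bound from finitely supported functions to all functions:
    finitely many values of [A f] only see a truncation of [f]. *)
Lemma local_bound A q : local_operator A -> 0 <= q ->
  (forall f s, uniq s -> supported s f -> ell2_le (A f) (q * sumsq s f)) ->
  forall f M, ell2_le f M -> ell2_le (A f) (q * M).
Proof.
move=> locA q0 Aq f M fM s us.
have [w wP] : exists w : V -> seq V, forall v f g,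
    (forall u, u \in w v -> f u = g u) -> A f v = A g v.
  exists (fun v => sval (cid (local_ext v locA))) => v f' g'.
  by case: cid => w' /=; apply.
pose W := undup (flatten (map w s)).
pose f' v := if v \in W then f v else 0.
have -> : sumsq s (A f) = sumsq s (A f').
  apply: eq_big_seq => v vs; congr normsq; apply: wP => u uv.
  rewrite /f' mem_undup ifT//; apply/flattenP; exists (w v) => //.
  exact: map_f.
have uW : uniq W by exact: undup_uniq.
apply: (le_trans (Aq f' W uW _ s us)); first by move=> v /negPf vW; rewrite /f' vW.
rewrite ler_wpM2l// (_ : sumsq W f' = sumsq W f); first exact: fM.
by apply: eq_big_seq => v vW; rewrite /f' vW.
Qed.

End LocalOperators.

(** The square of [A] is inverted instead of [A]: for a symmetric [A] that is
    bounded and bounded below, [1 - c A^2] is a contraction for a small [c]. *)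
Section Neumann.
Context {R : realType} {V : choiceType} (A : (V -> R[i]) -> V -> R[i]).
Variables (C q c : R).
Hypotheses (locA : local_operator A) (q01 : 0 <= q < 1).

Let K (f : V -> R[i]) : V -> R[i] := fun v => f v - c%:C%C * A (A f) v.

Hypotheses (A_le : forall f M, ell2_le f M -> ell2_le (A f) (C * M))
  (K_le : forall f M, ell2_le f M -> ell2_le (K f) (q * M)).

Let P f n v : R[i] := \sum_(k < n) iter k K f v.
Let S f v : R[i] := clim (fun n => c%:C%C * P (A f) n v).

Let AK f : A (K f) = K (A f).
Proof. by apply/funext => v; rewrite /K localB// localZ. Qed.

Let iterK_le f M k : ell2_le f M -> ell2_le (iter k K f) (q ^+ k * M).
Proof.
move=> fM; elim: k => [|k IH]; first by rewrite expr0 mul1r.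
by rewrite exprS -mulrA iterS; exact: K_le.
Qed.

Let AiterK f k : A (iter k K f) = iter k K (A f).
Proof. by elim: k => [//|k IH]; rewrite iterS AK IH. Qed.

Let AP f n : A (P f n) = P (A f) n.
Proof.
apply/funext => v; rewrite /P.
by rewrite local_sum//; apply: eq_bigr => k _; rewrite AiterK.
Qed.

(** Telescoping: [c A^2 = 1 - K]. *)
Let AAP f n v : c%:C%C * A (A (P f n)) v = f v - iter n K f v.
Proof.
rewrite !AP /P mulr_sumr.
rewrite (eq_bigr (fun k : 'I_n => iter k K f v - iter k.+1 K f v)); last first.
  move=> k _; rewrite iterS [K (iter k K f) v]/K opprB addrC subrK.
  by rewrite !AiterK.
elim: n => [|n IH]; first by rewrite big_ord0 subrr.
by rewrite big_ord_recr/= IH addrA subrK.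
Qed.

Let cvg_iterK f M v : ell2_le f M -> ccvg (fun n => f v - iter n K f v) (f v).
Proof.
move=> fM; rewrite -[X in ccvg _ X]subr0.
apply: ccvgD; first exact: ccvg_cst.
have M0 := ell2_le_ge0 fM.
rewrite oppr0; apply: (ccvg_geometric0 q01 M0) => n; rewrite normsqN.
exact/ell2_le_normsq/iterK_le.
Qed.

Let cvg_S f M v : ell2_le f M ->
  ccvg (fun n => c%:C%C * P (A f) n v) (S f v).
Proof.
move=> fM; have Af := A_le fM.
have M0 := ell2_le_ge0 Af.
pose z k := c%:C%C * iter k K (A f) v.
have zP n : c%:C%C * P (A f) n v = \sum_(k < n) z k by rewrite /P mulr_sumr.
rewrite /S; under [X in ccvg X _]eq_fun do rewrite zP.
under [X in clim X]eq_fun do rewrite zP.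
apply: (@ccvg_geometric_series _ _ q (c ^+ 2 * (C * M))) => //.
  by rewrite mulr_ge0// sqr_ge0.
move=> n; rewrite normsqM normsq_real mulrCA ler_wpM2l ?sqr_ge0//.
exact/ell2_le_normsq/iterK_le.
Qed.

Let AS f M : ell2_le f M -> A (S f) = f.
Proof.
move=> fM; apply/funext => v.
apply: (ccvg_unique (local_cvg v locA (fun u => cvg_S u fM))).
have -> : (fun n => A (fun u => c%:C%C * P (A f) n u) v) =
    (fun n => f v - iter n K f v).
  by apply/funext => n; rewrite -AAP AP localZ.
exact: (cvg_iterK v fM).
Qed.

Let SA f M : ell2_le f M -> S (A f) = f.
Proof.
move=> fM; apply/funext => v.
apply: (ccvg_unique (cvg_S v (A_le fM))).
have -> : (fun n => c%:C%C * P (A (A f)) n v) =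
    (fun n => f v - iter n K f v).
  by apply/funext => n; rewrite -AAP !AP.
exact: (cvg_iterK v fM).
Qed.

(** The partial sums satisfy [P f n.+1 = f + K (P f n)], which is stable once the
    weight [t = (1 - q) / 2] makes [(1 + t) * q] smaller than 1. *)
Let P_le f M n : ell2_le f M -> ell2_le (P f n) (6 / (1 - q) ^+ 2 * M).
Proof.
move=> fM; have M0 := ell2_le_ge0 fM; have /andP[q0 q1] := q01.
have p0 : 0 < 1 - q by rewrite subr_gt0.
elim: n => [|n IH].
  move=> s _; rewrite /sumsq big1 ?mulr_ge0 ?invr_ge0 ?sqr_ge0// => v _.
  by rewrite /P big_ord0 normsq0.
have -> : P f n.+1 = (fun v => f v + K (P f n) v).
  apply/funext => v; rewrite [K (P f n) v]/K AAP /P big_ord_recr/=.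
  by ring.
have t0 : 0 < (1 - q) / 2 by rewrite divr_gt0.
move=> s us; apply: le_trans (ell2_leD t0 fM (K_le IH) us) _.
have -> : (1 + ((1 - q) / 2)^-1) * M +
    (1 + (1 - q) / 2) * (q * (6 / (1 - q) ^+ 2 * M)) =
    6 / (1 - q) ^+ 2 * M - M * ((3 - 2 * q) / (1 - q)).
  by field; rewrite gt_eqF.
by rewrite gerBl mulr_ge0// divr_ge0 ?ltW//; lra.
Qed.

(** The inverse is [sum_k c K^k A], since [c A^2 = 1 - K] and [K] commutes with
    [A]. The series is summed at every site separately, and its bound is
    inherited from the partial sums. *)
Lemma neumann_inverse : exists S, bounded_on_ell2 S /\
  forall f, ell2 f -> S (A f) = f /\ A (S f) = f.
Proof.
exists S; split; last first.
  by move=> f /ell2P[M fM]; split; [exact: SA fM|exact: AS fM].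
exists (c ^+ 2 * (6 / (1 - q) ^+ 2 * C)) => f /ell2_normsq_fine[M fM ->].
apply/ell2_normsqP => s us.
have cv := @sum_normsq_cvg _ _ s _ _ (fun v => cvg_S v fM).
rewrite /sumsq -(cvg_lim _ cv)//; apply: limr_le; first by apply/cvg_ex; eexists; exact: cv.
near=> n; have := ell2_leZ c (P_le n (A_le fM)) us.
by rewrite /sumsq !mulrA.
Unshelve. all: by end_near. Qed.

End Neumann.

(** * Bloch-Floquet decomposition *)

Section RootsOfUnity.
Context {R : realType}.

(** The half angle lies in [(0, pi)], where the sine is positive. *)
Lemma expi_neq1 (x : R) : 0 < x < 2 * pi -> expi x != 1.
Proof.
move=> /andP[x0 x2]; apply/eqP => /(congr1 (@complex.Re R)) /= cx.
have s0 : 0 < sin (x / 2) by apply: sin_gt0_pi; apply/andP; split; lra.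
have := cosD (x / 2) (x / 2).
have -> : x / 2 + x / 2 = x by lra.
have := cos2Dsin2 (x / 2); rewrite cx; nra.
Qed.

Lemma expi_int_neq1 (N : nat) (k : int) : (0 < N)%N -> k != 0 ->
  k < N%:Z -> - k < N%:Z -> expi (k%:~R * (2 * pi / N%:R) : R) != 1.
Proof.
move=> N0 kn0; have NR : (0 : R) < N%:R by rewrite ltr0n.
have pipos := pi_gt0 R.
wlog kpos : k kn0 / 0 < k.
  move=> H; have [|kneg] := ltP 0 k; first exact: H.
  move=> k1 k2; have := H (- k); rewrite oppr_eq0 opprK rmorphN mulNr expiN.
  rewrite oppr_gt0 lt_neqAle kn0 kneg => /(_ isT isT k2 k1).
  by apply: contra => /eqP ->; rewrite conjC1.
move=> k1 _; apply: expi_neq1; apply/andP; split.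
  by rewrite mulr_gt0 ?ltr0z// divr_gt0// mulr_gt0.
rewrite mulrCA gtr_pMr ?mulr_gt0// ltr_pdivrMr// mul1r.
by rewrite -[N%:R]/(N%:Z%:~R) ltr_int.
Qed.

Lemma sum_expi_grid (N : nat) (k : int) : (0 < N)%N -> (k < N%:Z) -> (- k < N%:Z) ->
  \sum_(a < N) expi (k%:~R * (2 * pi * a%:R / N%:R) : R) =
  if k == 0 then N%:R else 0.
Proof.
move=> N0 k1 k2; have NR : (0 : R) < N%:R by rewrite ltr0n.
have [->|kn0] := eqVneq k 0.
  under eq_bigr do rewrite mul0r expi0.
  by rewrite sumr_const card_ord.
pose x : R := k%:~R * (2 * pi / N%:R).
have ze (a : 'I_N) : expi (k%:~R * (2 * pi * a%:R / N%:R) : R) = expi x ^+ a.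
  by rewrite -expi_nat /x; congr expi; ring.
under eq_bigr do rewrite ze.
have x1 : expi x != 1 by exact: expi_int_neq1.
apply: (mulfI (_ : expi x - 1 != 0)); first by rewrite subr_eq0.
rewrite mulr0 -subrX1 -expi_nat.
have -> : N%:R * x = 2 * pi * k%:~R by rewrite /x; field; rewrite gt_eqF.
by rewrite expi_2pi_int subrr.
Qed.

End RootsOfUnity.

Section Fourier.
Context {R : realType} {d : nat} {W : finType}.
Implicit Types (F : W * 'rV[int]_d -> R[i]) (s : seq 'rV[int]_d).

Definition int_rV (k : 'rV[int]_d) : 'rV[R]_d := map_mx intr k.

Lemma inner_int_rVD k l (theta : 'rV[R]_d) :
  inner (int_rV (k + l)) theta = inner (int_rV k) theta + inner (int_rV l) theta.
Proof. by rewrite -innerD; congr inner; apply/rowP => i; rewrite !mxE rmorphD. Qed.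

Lemma inner_int_rVN k (theta : 'rV[R]_d) :
  inner (int_rV (- k)) theta = - inner (int_rV k) theta.
Proof. by rewrite -innerN; congr inner; apply/rowP => i; rewrite !mxE rmorphN. Qed.

Definition fourier s F (theta : 'rV[R]_d) (w : W) : R[i] :=
  \sum_(k <- s) expi (- inner (int_rV k) theta) * F (w, k).

Definition cell_supported s F := forall w k, k \notin s -> F (w, k) = 0.

Definition cell_sumsq s F : R := \sum_w \sum_(k <- s) normsq (F (w, k)).

Lemma sum_supported (A : nmodType) (f : 'rV[int]_d -> A) s t : uniq s -> uniq t ->
  (forall k, k \notin s -> f k = 0) -> (forall k, k \notin t -> f k = 0) ->
  \sum_(k <- s) f k = \sum_(k <- t) f k.
Proof.
have sum_filter r : uniq r -> \sum_(k <- r) f k =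
    \sum_(k <- [seq k <- r | f k != 0]) f k.
  move=> ur; rewrite big_filter (bigID (fun k => f k != 0))/=.
  by rewrite [X in _ + X]big1 ?addr0// => k /negPn/eqP.
move=> us ut fs ft; rewrite (sum_filter s us) (sum_filter t ut).
apply/perm_big/uniq_perm; rewrite ?filter_uniq// => k; rewrite !mem_filter.
apply: andb_id2l => fk.
have [ks|/fs/eqP] := boolP (k \in s); last by rewrite (negPf fk).
by have [kt|/ft/eqP] := boolP (k \in t); last by rewrite (negPf fk).
Qed.

Lemma fourier_supported s t F theta : uniq s -> uniq t ->
  cell_supported s F -> cell_supported t F -> fourier s F theta = fourier t F theta.
Proof.
move=> us ut Fs Ft; apply/funext => w.
by apply: sum_supported => // k; [move=> /(Fs w)|move=> /(Ft w)] => ->; rewrite mulr0.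
Qed.

Section Parseval.
Variable N : nat.
Hypothesis N0 : (0 < N)%N.

Definition grid (j : {ffun 'I_d -> 'I_N}) : 'rV[R]_d :=
  \row_i (2 * pi * (j i)%:R / N%:R).

Lemma sum_grid (k : 'rV[int]_d) : (forall i, `|k 0 i| < N%:Z) ->
  \sum_j expi (inner (int_rV k) (grid j)) = if k == 0 then (N ^ d)%:R else 0.
Proof.
move=> kN.
transitivity (\prod_(i < d) \sum_(a < N)
    expi ((k 0 i)%:~R * (2 * pi * a%:R / N%:R) : R)).
  rewrite bigA_distr_bigA; apply: eq_bigr => j _.
  rewrite /inner expi_sum; apply: eq_bigr => i _.
  by rewrite !mxE.
have e i : \sum_(a < N) expi ((k 0 i)%:~R * (2 * pi * a%:R / N%:R) : R) =
    if k 0 i == 0 then N%:R else 0.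
  by apply: sum_expi_grid => //; have := kN i; lia.
under eq_bigr do rewrite e.
have [->|kn0] := eqVneq k 0.
  under eq_bigr do rewrite mxE eqxx.
  by rewrite prodr_const card_ord natrX.
have [i ki] : exists i, k 0 i != 0.
  apply/existsP; rewrite -negb_forall; apply: contra kn0 => /forallP h.
  by apply/eqP/rowP => i; rewrite mxE; apply/eqP.
by rewrite (bigD1 i)//= (negPf ki) mul0r.
Qed.

(** Parseval's identity on a grid of quasimomenta fine enough to separate the
    points of the support. *)
Lemma parseval s F : uniq s ->
  (forall k l i, k \in s -> l \in s -> `|(k - l) 0 i| < N%:Z) ->
  \sum_j \sum_w normsq (fourier s F (grid j) w) = (N ^ d)%:R * cell_sumsq s F.
Proof.
move=> us sN; rewrite exchange_big /cell_sumsq mulr_sumr.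
apply: eq_bigr => w _; apply: (@complexI R).
rewrite rmorph_sum rmorphM rmorph_nat rmorph_sum /=.
transitivity (\sum_(k <- s) \sum_(l <- s) ((F (w, k))^* * F (w, l)) *
    \sum_j expi (inner (int_rV (k - l)) (grid j))).
  under [RHS]eq_bigr do under eq_bigr do rewrite mulr_sumr.
  under [RHS]eq_bigr do rewrite exchange_big/=.
  rewrite [RHS]exchange_big; apply: eq_bigr => j _ /=.
  rewrite normsqE /fourier rmorph_sum mulr_suml; apply: eq_bigr => k _.
  rewrite mulr_sumr; apply: eq_bigr => l _.
  rewrite inner_int_rVD inner_int_rVN expiD rmorphM /= expiN conjCK.
  by ring.
rewrite mulr_sumr; apply: eq_big_seq => k ks.
rewrite (bigD1_seq k)//= subrr sum_grid ?eqxx; last first.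
  by move=> i; rewrite -(subrr k); exact: sN.
rewrite big_seq_cond big1 ?addr0; first by rewrite -normsqE mulrC.
move=> l /andP[ls lk]; rewrite sum_grid ?subr_eq0; last by move=> i; exact: sN.
by rewrite eq_sym (negPf lk) mulr0.
Qed.

End Parseval.

Lemma separating_grid s : exists2 N : nat, (0 < N)%N &
  forall k l i, k \in s -> l \in s -> `|(k - l) 0 i| < N%:Z.
Proof.
pose B := (\sum_(k <- s) \sum_i `|k 0%R i|)%N.
have kB (k : 'rV[int]_d) i : k \in s -> (`|k 0%R i| <= B)%N.
  move=> ks; rewrite /B (big_rem k)//= (bigD1 i)//=.
  by rewrite -addnA leq_addr.
(* differences of two points of s are bounded by 2 B *)
exists (B + B).+1 => // k l i /(kB _ i) kb /(kB _ i) lb.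
rewrite !mxE; move: (k 0 i) (l 0 i) kb lb => a b; clearbody B; lia.
Qed.

(** [B] acts on Fourier transforms of finitely supported functions as
    multiplication by the operator-valued function [b]. *)
Definition has_symbol (B : (W * 'rV[int]_d -> R[i]) -> W * 'rV[int]_d -> R[i])
    (b : 'rV[R]_d -> (W -> R[i]) -> W -> R[i]) :=
  forall F s, uniq s -> cell_supported s F -> exists s',
  [/\ uniq s', cell_supported s' (B F) &
      forall theta, fourier s' (B F) theta = b theta (fourier s F theta)].

Lemma has_symbol_comp B b B' b' : has_symbol B b -> has_symbol B' b' ->
  has_symbol (fun F => B (B' F)) (fun theta u => b theta (b' theta u)).
Proof.
move=> Bb Bb' F s us sF; have [s' [us' sF' fs']] := Bb' F s us sF.
have [t [ut tF ft]] := Bb _ s' us' sF'.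
by exists t; split=> // theta; rewrite ft fs'.
Qed.

Lemma has_symbol_subZ B b c : has_symbol B b ->
  has_symbol (fun F x => F x - c * B F x)
    (fun theta u w => u w - c * b theta u w).
Proof.
move=> Bb F s us sF; have [s' [us' sF' fs']] := Bb F s us sF.
pose t := undup (s ++ s'); have ut : uniq t by exact: undup_uniq.
have tF : cell_supported t F.
  by move=> w k; rewrite mem_undup mem_cat => /norP[/sF].
have tF' : cell_supported t (B F).
  by move=> w k; rewrite mem_undup mem_cat => /norP[_ /sF'].
exists t; split=> // [w k kt|theta]; first by rewrite tF// tF'// mulr0 subrr.
rewrite -fs' (fourier_supported theta us ut sF tF).
rewrite (fourier_supported theta us' ut sF' tF').
apply/funext => w; rewrite /fourier mulr_sumr -sumrB.
by apply: eq_bigr => k _; ring.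
Qed.

(** Finitely many quasimomenta suffice for a given function, so a bound on the
    symbol over the torus bounds the operator. *)
Lemma symbol_bound B b (q : R) F s : has_symbol B b -> 0 <= q ->
  (forall (theta : 'rV[R]_d) u, (forall i, 0 <= theta 0 i <= 2 * pi) ->
    \sum_w normsq (b theta u w) <= q * \sum_w normsq (u w)) ->
  uniq s -> cell_supported s F -> exists s',
  [/\ uniq s', cell_supported s' (B F)
    & cell_sumsq s' (B F) <= q * cell_sumsq s F].
Proof.
move=> Bb q0 bq us sF; have [s' [us' sF' fs']] := Bb F s us sF.
exists s'; split=> //.
have [N N0 sep] := separating_grid (s' ++ s).
have p1 := @parseval N N0 s' (B F) us' _.
have p2 := @parseval N N0 s F us _.
have Nd : (0 : R) < (N ^ d)%:R by rewrite ltr0n expn_gt0 N0.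
rewrite -(ler_pM2l Nd) -p1; last first.
  by move=> k l i ks ls; apply: sep; rewrite mem_cat ?ks ?ls.
rewrite mulrCA -p2; last first.
  by move=> k l i ks ls; apply: sep; rewrite mem_cat ?ks ?ls orbT.
rewrite mulr_sumr; apply: ler_sum => j _; rewrite fs'; apply: bq => i.
rewrite mxE; have pi0 := pi_gt0 R; have NR : (0 : R) < N%:R by rewrite ltr0n.
apply/andP; split.
  by rewrite !mulr_ge0 ?invr_ge0 ?ler0n ?(ltW pi0).
rewrite ler_pdivrMr// ler_pM2l ?mulr_gt0// ler_nat.
exact/ltnW.
Qed.

End Fourier.

(** * Uniform bounds over the torus *)

Section ContinuousMatrices.
Context {R : realType} {d : nat}.
Implicit Types (g h : 'rV[R]_d -> R[i]).

Let contD (f g : 'rV[R]_d -> R) : continuous f -> continuous g ->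
  continuous (fun t => f t + g t).
Proof.
by move=> cf cg x; have h := @continuousD R R _ f g x (cf x) (cg x); exact h.
Qed.

Let contB (f g : 'rV[R]_d -> R) : continuous f -> continuous g ->
  continuous (fun t => f t - g t).
Proof.
by move=> cf cg x; have h := @continuousB R R _ f g x (cf x) (cg x); exact h.
Qed.

Let contM (f g : 'rV[R]_d -> R) : continuous f -> continuous g ->
  continuous (fun t => f t * g t).
Proof.
by move=> cf cg x; have h := @continuousM R _ f g x (cf x) (cg x); exact h.
Qed.

Definition ccontinuous g :=
  continuous (fun theta => complex.Re (g theta)) /\
  continuous (fun theta => complex.Im (g theta)).

Lemma ccontinuous_cst c : ccontinuous (fun=> c).
Proof. by split=> x; exact: cst_continuous. Qed.

Lemma ccontinuousD g h : ccontinuous g -> ccontinuous h ->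
  ccontinuous (fun t => g t + h t).
Proof.
move=> [a b] [a' b']; split.
  by under eq_fun do rewrite ReD; exact: contD.
by under eq_fun do rewrite ImD; exact: contD.
Qed.

Lemma ccontinuousM g h : ccontinuous g -> ccontinuous h ->
  ccontinuous (fun t => g t * h t).
Proof.
move=> [a b] [a' b']; split.
  by under eq_fun do rewrite ReM; apply: contB; exact: contM.
by under eq_fun do rewrite ImM; apply: contD; exact: contM.
Qed.

Lemma ccontinuous_sum (I : Type) (r : seq I) (P : pred I) (g : I -> 'rV[R]_d -> R[i]) :
  (forall i, ccontinuous (g i)) -> ccontinuous (fun t => \sum_(i <- r | P i) g i t).
Proof.
move=> gc; elim: r => [|i r IH].
  by under eq_fun do rewrite big_nil; exact: ccontinuous_cst.
under eq_fun do rewrite big_cons.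
by case: (P i) => //; exact: ccontinuousD.
Qed.

Lemma ccontinuous_prod (I : Type) (r : seq I) (P : pred I) (g : I -> 'rV[R]_d -> R[i]) :
  (forall i, ccontinuous (g i)) -> ccontinuous (fun t => \prod_(i <- r | P i) g i t).
Proof.
move=> gc; elim: r => [|i r IH].
  by under eq_fun do rewrite big_nil; exact: ccontinuous_cst.
under eq_fun do rewrite big_cons.
by case: (P i) => //; exact: ccontinuousM.
Qed.

Lemma ccontinuous_det n (B : 'rV[R]_d -> 'M[R[i]]_n) :
  (forall i j, ccontinuous (fun t => B t i j)) -> ccontinuous (fun t => \det (B t)).
Proof.
move=> Bc; rewrite /determinant; apply: ccontinuous_sum => p.
apply: ccontinuousM; first exact: ccontinuous_cst.
by apply: ccontinuous_prod => i; exact: Bc.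
Qed.

Lemma ccontinuous_adj n (B : 'rV[R]_d -> 'M[R[i]]_n) i j :
  (forall i j, ccontinuous (fun t => B t i j)) ->
  ccontinuous (fun t => (\adj (B t)) i j).
Proof.
move=> Bc; under eq_fun do rewrite mxE /cofactor.
apply: ccontinuousM; first exact: ccontinuous_cst.
apply: ccontinuous_det => k l; under eq_fun do rewrite !mxE.
exact: Bc.
Qed.

Lemma continuous_normsq g : ccontinuous g -> continuous (fun t => normsq (g t)).
Proof.
move=> [a b]; rewrite /normsq; under eq_fun do rewrite !expr2.
by apply: contD; exact: contM.
Qed.

Lemma continuous_sumr (I : Type) (r : seq I) (g : I -> 'rV[R]_d -> R) :
  (forall i, continuous (g i)) -> continuous (fun t => \sum_(i <- r) g i t).
Proof.
move=> gc; elim: r => [|i r IH].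
  by under eq_fun do rewrite big_nil; move=> x; exact: cst_continuous.
under eq_fun do rewrite big_cons.
exact: contD.
Qed.

Lemma ccontinuous_expi (a : R) (t : 'rV[R]_d) :
  ccontinuous (fun theta => expi (a + inner t theta)).
Proof.
have c : continuous (fun theta => a + inner t theta).
  apply: contD; first by move=> x; exact: cst_continuous.
  apply: continuous_sumr => i; apply: contM; first by move=> x; exact: cst_continuous.
  exact: coord_continuous.
split=> x.
  by apply: continuous_comp; [exact: c|exact: continuous_cos].
by apply: continuous_comp; [exact: c|exact: continuous_sin].
Qed.

Lemma continuous_bounded_box (g : 'rV[R]_d -> R) : continuous g ->
  exists2 M : R, 1 <= M &
    forall theta : 'rV[R]_d, (forall i, 0 <= theta 0 i <= 2 * pi) -> g theta <= M.
Proof.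
move=> gc; pose A := [set t : 'rV[R]_d | forall i, (`[0, 2 * pi]%classic : set R) (t 0 i)].
have cA : compact A.
  apply: (@rV_compact _ _ (fun=> `[0, 2 * pi]%classic : set R)) => _.
  exact: segment_compact.
have A0 : A !=set0.
  exists 0 => i; rewrite /= mxE in_itv /= lexx mulr_ge0//; exact: pi_ge0.
have [c _ cP] := EVT_max_rV A0 cA (continuous_subspaceT gc).
exists (Num.max 1 (g c)); first by rewrite le_max lexx.
move=> t tP; rewrite le_max; apply/orP; right; apply: cP.
by rewrite inE => i; rewrite /= in_itv /= tP.
Qed.

End ContinuousMatrices.

Section Frobenius.
Context {R : realType}.

Definition frobenius n (M : 'M[R[i]]_n) : R := \sum_i \sum_j normsq (M i j).

Lemma mulmx_normsq_le n (M : 'M[R[i]]_n) (x : 'cV[R[i]]_n) :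
  \sum_i normsq ((M *m x) i 0) <= frobenius M * \sum_i normsq (x i 0).
Proof.
rewrite /frobenius mulr_suml; apply: ler_sum => i _.
by rewrite mxE; exact: cauchy_schwarz.
Qed.

Context {V : finType}.
Variable T : (V -> R[i]) -> V -> R[i].
Hypothesis TL : forall x, lin_functional (T^~ x).

Let colv (u : V -> R[i]) : 'cV[R[i]]_#|V| := \col_j u (enum_val j).

Let colvT u : colv (T u) = operator_mx T *m colv u.
Proof.
apply/colP => i; rewrite !mxE -(operator_mxE u _ TL) enum_valK.
by apply: eq_bigr => j _; rewrite [colv u _ _]mxE.
Qed.

Let sum_colv u : \sum_i normsq (colv u i 0) = \sum_w normsq (u w).
Proof.
rewrite [RHS](reindex enum_val (onW_bij _ (enum_val_bij V))).
by apply: eq_bigr => i _; rewrite mxE.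
Qed.

Lemma operator_normsq_le u : \sum_w normsq (T u w) <=
  frobenius (operator_mx T) * \sum_w normsq (u w).
Proof. by rewrite -!sum_colv colvT; exact: mulmx_normsq_le. Qed.

Lemma operator_normsq_ge u : \det (operator_mx T) != 0 ->
  \sum_w normsq (u w) <=
  frobenius (\adj (operator_mx T)) / normsq (\det (operator_mx T)) *
  \sum_w normsq (T u w).
Proof.
move=> T0; have Tu : operator_mx T \in unitmx by rewrite unitmxE unitfE.
have -> : frobenius (\adj (operator_mx T)) / normsq (\det (operator_mx T)) =
    frobenius (invmx (operator_mx T)).
  rewrite /frobenius mulr_suml; apply: eq_bigr => i _.
  rewrite mulr_suml; apply: eq_bigr => j _.
  rewrite /invmx Tu [in RHS]mxE normsqM mulrC; congr (_ * _).
  have n0 : normsq (\det (operator_mx T)) != 0 by rewrite normsq_eq0.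
  by apply: (mulfI n0); rewrite mulfV// -normsqM mulfV// (normsq_real 1) expr1n.
have -> : \sum_w normsq (u w) =
    \sum_i normsq ((invmx (operator_mx T) *m colv (T u)) i 0).
  by rewrite colvT mulKmx// sum_colv.
by rewrite -(sum_colv (T u)); exact: mulmx_normsq_le.
Qed.

Lemma hermitian_symmetric u v : operator_mx T \is hermsymmx ->
  \sum_w (u w)^* * T v w = \sum_w (T u w)^* * v w.
Proof.
move=> /is_hermitianmxP; rewrite expr0 scale1r => TE.
have TC i j : (operator_mx T i j)^* = operator_mx T j i.
  by rewrite [in RHS]TE !mxE.
have sum_rank (F : V -> R[i]) : \sum_w F w = \sum_(j < #|V|) F (enum_val j).
  by rewrite (reindex enum_val (onW_bij _ (enum_val_bij V))).
rewrite !sum_rank.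
transitivity (\sum_i \sum_j
    (u (enum_val i))^* * (operator_mx T i j * v (enum_val j))).
  apply: eq_bigr => i _; rewrite -(operator_mxE v _ TL) mulr_sumr.
  by apply: eq_bigr => j _; rewrite enum_valK.
rewrite exchange_big; apply: eq_bigr => j _.
rewrite -(operator_mxE u _ TL) rmorph_sum mulr_suml; apply: eq_bigr => i _.
by rewrite enum_valK rmorphM /= TC; ring.
Qed.

End Frobenius.

(** * Inverting a periodic operator *)

Section Cells.
Context {R : realType} {d : nat} {W : finType}.
Implicit Types (F : W * 'rV[int]_d -> R[i]) (s : seq 'rV[int]_d).

Definition cells s : seq (W * 'rV[int]_d) := [seq (w, k) | w <- enum W, k <- s].

Lemma mem_cells s w k : ((w, k) \in cells s) = (k \in s).
Proof.
apply/allpairsP/idP => [[[w' k'] /= [_ k's [_ ->]]]//|ks].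
by exists (w, k); split=> //=; rewrite mem_enum.
Qed.

Lemma uniq_cells s : uniq s -> uniq (cells s).
Proof.
by move=> us; apply: allpairs_uniq => //; [exact: enum_uniq|case=> ? ? [? ?]].
Qed.

Lemma sumsq_cells s F : sumsq (cells s) F = cell_sumsq s F.
Proof.
rewrite /sumsq /cells big_allpairs_dep big_enum.
by apply: eq_bigr => w _.
Qed.

Lemma cell_supportedE s F : cell_supported s F <-> supported (cells s) F.
Proof.
split=> sF; first by move=> [w k]; rewrite mem_cells; exact: sF.
by move=> w k ks; apply: sF; rewrite mem_cells.
Qed.

Lemma symbol_ell2_bound B b (q : R) : has_symbol B b -> local_operator B ->
  0 <= q ->
  (forall (theta : 'rV[R]_d) u, (forall i, 0 <= theta 0 i <= 2 * pi) ->
    \sum_w normsq (b theta u w) <= q * \sum_(w : W) normsq (u w)) ->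
  forall F M, ell2_le F M -> ell2_le (B F) (q * M).
Proof.
move=> Bb locB q0 bq; apply: local_bound => // F s us sF.
pose t := undup (map snd s); have ut : uniq t by exact: undup_uniq.
have tF : cell_supported t F.
  move=> w k kt; apply: sF; apply: contra kt => wks.
  by rewrite mem_undup; apply/mapP; exists (w, k).
have [t' [ut' tF' le]] := symbol_bound Bb q0 bq ut tF.
have ts : cell_sumsq t F = sumsq s F.
  rewrite -sumsq_cells; apply: sumsq_eq => //; last exact: uniq_cells.
  exact/cell_supportedE.
move=> r ur; apply: le_trans (supported_ell2_le _ (uniq_cells ut') ur) _.
  exact/cell_supportedE.
by rewrite sumsq_cells -ts.
Qed.

End Cells.

Section PeriodicHopping.
Context {R : realType} {d : nat} {W E : finType} (G : multigraph W E).
Variables (tau : E -> 'rV[int]_d) (alpha : E -> R) (q : W -> R).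
Hypotheses (tauG : one_form G tau) (alphaG : one_form G alpha).

(** The Schrodinger operator of a periodic graph in lattice coordinates: an edge
    [e] of the quotient leads from the cell [k] to the cell [k + tau e]. *)
Definition periodic_hopping (F : W * 'rV[int]_d -> R[i]) (x : W * 'rV[int]_d) : R[i] :=
  (q x.1)%:C%C * F x
  - \sum_(e | src G e == x.1) expi (alpha e) * F (tgt G e, x.2 + tau e).

(** The fiber operator of the index form [tau]; being integer valued, [tau]
    turns translations by cells into phases. *)
Definition bloch_operator (theta : 'rV[R]_d) : (W -> R[i]) -> W -> R[i] :=
  hopping_operator G finset.setT
    (fun e => alpha e + inner (int_rV (tau e)) theta) q.

Lemma periodic_hopping_local : local_operator periodic_hopping.
Proof.
move=> x; exists (((q x.1)%:C%C, x) ::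
  [seq (- expi (alpha e), (tgt G e, x.2 + tau e)) |
     e <- enum E & src G e == x.1]) => F.
rewrite big_cons big_map big_filter big_enum_cond/= /periodic_hopping -sumrN.
by congr (_ + _); apply: eq_bigr => e _; rewrite mulNr.
Qed.

Lemma fourier_shift s t (F : W * 'rV[int]_d -> R[i]) (a : 'rV[int]_d) theta w :
  uniq s -> uniq t -> cell_supported s F ->
  (forall k, k \in s -> k - a \in t) ->
  \sum_(k <- t) expi (- inner (int_rV k) theta) * F (w, k + a) =
  expi (inner (int_rV a) theta) * fourier s F theta w.
Proof.
move=> us ut sF st.
transitivity (\sum_(k <- [seq k + a | k <- t])
    expi (inner (int_rV a) theta) *
    (expi (- inner (int_rV k) theta) * F (w, k))).
  rewrite big_map; apply: eq_bigr => k _.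
  by rewrite mulrA -expiD inner_int_rVD; congr (expi _ * _); ring.
rewrite -mulr_sumr; congr (_ * _); apply: sum_supported => //.
- by rewrite map_inj_uniq//; exact: addIr.
- move=> k kt; rewrite sF ?mulr0//; apply: contra kt => /st kat.
  by apply/mapP; exists (k - a); rewrite ?subrK.
- by move=> k /(sF w) ->; rewrite mulr0.
Qed.

Lemma periodic_hopping_symbol : has_symbol periodic_hopping bloch_operator.
Proof.
move=> F s us sF.
pose t := undup (s ++ [seq k - tau e | k <- s, e <- enum E]).
have ut : uniq t by exact: undup_uniq.
have st k : k \in s -> k \in t by move=> ks; rewrite mem_undup mem_cat ks.
have stau e k : k \in s -> k - tau e \in t.
  move=> ks; rewrite mem_undup mem_cat; apply/orP; right.
  by apply: allpairs_f => //; rewrite mem_enum.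
have tF : cell_supported t F.
  by move=> w k kt; apply: sF; apply: contra kt; exact: st.
exists t; split=> //.
  move=> w k kt; rewrite /periodic_hopping tF//= mulr0 sub0r big1 ?oppr0// => e _.
  rewrite sF ?mulr0//; apply: contra kt => /(stau e).
  by rewrite addrK.
move=> theta; apply/funext => w; rewrite /bloch_operator /hopping_operator.
rewrite {1}/fourier /periodic_hopping /=.
under eq_bigr do rewrite mulrBr.
rewrite sumrB; congr (_ - _).
  rewrite (fourier_supported theta us ut sF tF) /fourier mulr_sumr.
  by apply: eq_bigr => k _; rewrite mulrCA.
under [LHS]eq_bigr do rewrite mulr_sumr.
rewrite [LHS]exchange_big; apply: eq_big => e; first by rewrite finset.in_setT.
move=> _; rewrite expiD -mulrA -(fourier_shift _ _ us ut sF (stau e)).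
by rewrite mulr_sumr; apply: eq_bigr => k _; rewrite mulrCA.
Qed.

Lemma bloch_lin theta w : lin_functional ((bloch_operator theta)^~ w).
Proof. exact: hopping_lin. Qed.

Lemma bloch_hermitian theta : operator_mx (bloch_operator theta) \is hermsymmx.
Proof.
apply: hopping_hermitian; first exact: inv_closedT.
move=> e; rewrite alphaG tauG opprD; congr (_ + _).
exact: inner_int_rVN.
Qed.

Lemma bloch_ccontinuous i j :
  ccontinuous (fun theta => operator_mx (bloch_operator theta) i j).
Proof.
under eq_fun do rewrite mxE /bloch_operator /hopping_operator -sumrN.
apply: ccontinuousD; first exact: ccontinuous_cst.
apply: ccontinuous_sum => e; under eq_fun do rewrite -mulNr mulrC -mulN1r mulrA.
apply: ccontinuousM; first exact: ccontinuous_cst.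
exact: ccontinuous_expi.
Qed.

(** Expand the square: the cross term is [2 / a] times the squared norm of
    [T u], because [T] is symmetric; half of it absorbs the last term, and the
    other half is bounded below by the norm of [u]. *)
Lemma bloch_contraction (T : (W -> R[i]) -> W -> R[i]) (a b : R) u :
  (forall x, lin_functional (T^~ x)) -> operator_mx T \is hermsymmx -> 0 < a -> 0 < b ->
  (forall v, \sum_w normsq (T v w) <= a * \sum_w normsq (v w)) ->
  (forall v, \sum_w normsq (v w) <= b * \sum_w normsq (T v w)) ->
  \sum_w normsq (u w - (a^-1)%:C%C * T (T u) w) <=
  (1 - (a * b)^-1) * \sum_w normsq (u w).
Proof.
move=> TL hT a0 b0 Ta Tb.
have cross : \sum_w complex.Re ((u w)^* * T (T u) w) = \sum_w normsq (T u w).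
  rewrite -Re_sum hermitian_symmetric// Re_sum; apply: eq_bigr => w _.
  by rewrite -normsqE.
have -> : \sum_w normsq (u w - (a^-1)%:C%C * T (T u) w) =
    \sum_w normsq (u w) + a^-1 ^+ 2 * \sum_w normsq (T (T u) w)
    - 2 * a^-1 * \sum_w normsq (T u w).
  rewrite -cross !mulr_sumr -big_split -sumrB; apply: eq_bigr => w _ /=.
  rewrite normsqD normsqN normsqM normsq_real mulrN ReN mulrCA Re_realM.
  by ring.
have h1 : a^-1 ^+ 2 * \sum_w normsq (T (T u) w) <= a^-1 * \sum_w normsq (T u w).
  rewrite expr2 -mulrA ler_pM2l ?invr_gt0// -(ler_pM2l a0) mulVKf ?gt_eqF//.
have h2 : (a * b)^-1 * \sum_w normsq (u w) <= a^-1 * \sum_w normsq (T u w).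
  rewrite invfM -mulrA ler_pM2l ?invr_gt0// -(ler_pM2l b0) mulVKf ?gt_eqF//.
by rewrite mulrBl mul1r; lra.
Qed.

(** The norms of the fibers and, as the determinants do not vanish, of their
    inverses are continuous functions of the quasimomentum, hence bounded on the
    torus; so the contraction holds uniformly over the fibers and passes to the
    periodic operator. *)
Lemma periodic_hopping_inverse :
  (forall theta, \det (operator_mx (bloch_operator theta)) != 0) ->
  exists S, bounded_on_ell2 S /\
  forall f, ell2 f -> S (periodic_hopping f) = f /\ periodic_hopping (S f) = f.
Proof.
move=> det0; pose B theta := operator_mx (bloch_operator theta).
have frob_cont (M : 'rV[R]_d -> 'M[R[i]]_#|W|) :
    (forall i j, ccontinuous (fun t => M t i j)) ->
    continuous (fun t => frobenius (M t)).
  move=> Mc; apply: continuous_sumr => i; apply: continuous_sumr => j.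
  exact/continuous_normsq/Mc.
have [a a1 aP] := continuous_bounded_box (frob_cont _ bloch_ccontinuous).
have inv_cont : continuous (fun t => frobenius (\adj (B t)) / normsq (\det (B t))).
  have ca : continuous (fun t => frobenius (\adj (B t))).
    by apply: frob_cont => i j; apply: ccontinuous_adj; exact: bloch_ccontinuous.
  have cd : continuous (fun t => (normsq (\det (B t)))^-1).
    have cn : continuous (fun t => normsq (\det (B t))).
      by apply: continuous_normsq; apply: ccontinuous_det; exact: bloch_ccontinuous.
    move=> x; apply: (@continuousV R _ (fun t => normsq (\det (B t))) x _ (cn x)).
    by rewrite normsq_eq0 det0.
  by move=> x; have h := @continuousM R _ _ _ x (ca x) (cd x); exact h.
have [b b1 bP] := continuous_bounded_box inv_cont.
have a0 : 0 < a by exact: lt_le_trans a1.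
have b0 : 0 < b by exact: lt_le_trans b1.
have sum0 (v : W -> R[i]) : 0 <= \sum_w normsq (v w).
  by apply: sumr_ge0 => w _; exact: normsq_ge0.
have Ba (theta : 'rV[R]_d) v : (forall i, 0 <= theta 0 i <= 2 * pi) ->
    \sum_w normsq (bloch_operator theta v w) <= a * \sum_w normsq (v w).
  move=> box; apply: le_trans (operator_normsq_le (bloch_lin theta) v) _.
  by rewrite ler_wpM2r// aP.
have Bb (theta : 'rV[R]_d) v : (forall i, 0 <= theta 0 i <= 2 * pi) ->
    \sum_w normsq (v w) <= b * \sum_w normsq (bloch_operator theta v w).
  move=> box; apply: le_trans (operator_normsq_ge (bloch_lin theta) v (det0 theta)) _.
  by rewrite ler_wpM2r// bP.
have ab1 : (a * b)^-1 <= 1 by rewrite invf_le1 ?mulr_gt0// mulr_ege1.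
have q01 : 0 <= 1 - (a * b)^-1 < 1.
  by rewrite subr_ge0 ab1 gtrBl invr_gt0 mulr_gt0.
apply: (@neumann_inverse _ _ _ a (1 - (a * b)^-1) a^-1).
- exact: periodic_hopping_local.
- by [].
- apply: (symbol_ell2_bound periodic_hopping_symbol periodic_hopping_local (ltW a0)).
  exact: Ba.
apply: (symbol_ell2_bound (has_symbol_subZ (a^-1)%:C%C
  (has_symbol_comp periodic_hopping_symbol periodic_hopping_symbol))).
- by apply: local_subZ; apply: local_comp; exact: periodic_hopping_local.
- by case/andP: q01.
move=> theta u box; apply: bloch_contraction => //.
- exact: bloch_lin.
- exact: bloch_hermitian.
- by move=> v; exact: Ba.
- by move=> v; exact: Bb.
Qed.

End PeriodicHopping.

(** * The spectrum lies in the bands *)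

Section LatticeCoordinates.
Context {R : realType} {d : nat} (G : periodic_graph R d).
Implicit Types (k l : 'rV[int]_d) (v : vert G) (e : edge G) (w : qvert G)
  (f : qedge G).

Lemma lattice_pointD k l : lattice_point (basis G) (k + l) =
  lattice_point (basis G) k + lattice_point (basis G) l.
Proof.
rewrite /lattice_point -mulmxDl; congr (_ *m _); apply/rowP => i.
by rewrite !mxE rmorphD.
Qed.

Lemma lattice_pointI : injective (lattice_point (basis G)).
Proof.
move=> k l /(can_inj (mulmxK (basis_unit G))) kl.
by apply/rowP => i; have /rowP/(_ i) := kl; rewrite !mxE => /intr_inj.
Qed.

Lemma vshiftD k l v : vshift (k + l) v = vshift k (vshift l v).
Proof.
by apply: (@pos_inj _ _ G); rewrite !pos_vshift lattice_pointD addrA addrAC.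
Qed.

Lemma vshift_free k l v : vshift k v = vshift l v -> k = l.
Proof.
by move=> /(congr1 (@pos _ _ G)); rewrite !pos_vshift => /addrI/lattice_pointI.
Qed.

Lemma vproj_vshift k v : vproj (vshift k v) = vproj v.
Proof. by apply/esym/vproj_eq; exists k. Qed.

Lemma eproj_eshift k e : eproj (eshift k e) = eproj e.
Proof. by apply/esym/eproj_eq; exists k. Qed.

(** A representative of every vertex of the quotient gives lattice coordinates
    on the vertices. *)
Definition representative w : vert G := projT1 (cid (vproj_surj w)).

Lemma vproj_representative w : vproj (representative w) = w.
Proof. by rewrite /representative; case: cid. Qed.

Definition place (x : qvert G * 'rV[int]_d) : vert G :=
  vshift x.2 (representative x.1).

Lemma vproj_place x : vproj (place x) = x.1.
Proof. by rewrite vproj_vshift vproj_representative. Qed.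

Lemma place_inj : injective place.
Proof.
move=> [w k] [w' k'] pp.
have ww : w = w' by have := congr1 (@vproj _ _ G) pp; rewrite !vproj_place.
by move: pp; rewrite -ww /place /= => /vshift_free ->.
Qed.

Lemma place_surj v : exists x, place x = v.
Proof.
have [k ->] : exists k, v = vshift k (representative (vproj v)).
  by apply/vproj_eq; rewrite vproj_representative.
by exists (vproj v, k).
Qed.

Definition unplace v : qvert G * 'rV[int]_d := sval (cid (place_surj v)).

Lemma unplaceK v : place (unplace v) = v.
Proof. by rewrite /unplace; case: cid. Qed.

Lemma placeK x : unplace (place x) = x.
Proof. by apply: place_inj; rewrite unplaceK. Qed.

Lemma vshift_place k x : vshift k (place x) = place (x.1, k + x.2).
Proof. by rewrite /place vshiftD. Qed.

Lemma edge_lift_exists f : exists e,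
  eproj e = f /\ src (graph G) e = representative (src (qgraph G) f).
Proof.
have [e ef] := eproj_surj f.
have [k sk] : exists k, src (graph G) e = vshift k (representative (src (qgraph G) f)).
  by apply/vproj_eq; rewrite vproj_representative -ef src_eproj.
exists (eshift (- k) e); rewrite eproj_eshift src_eshift sk -vshiftD addNr.
split=> //; apply: (@pos_inj _ _ G); rewrite pos_vshift.
by rewrite /lattice_point (_ : map_mx _ 0 = 0) ?mul0mx ?addr0//;
  apply/rowP => i; rewrite !mxE.
Qed.

Definition edge_lift f : edge G := sval (cid (edge_lift_exists f)).

Lemma eproj_edge_lift f : eproj (edge_lift f) = f.
Proof. by rewrite /edge_lift; case: cid => e []. Qed.

Lemma src_edge_lift f :
  src (graph G) (edge_lift f) = representative (src (qgraph G) f).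
Proof. by rewrite /edge_lift; case: cid => e []. Qed.

(** The cell in which the lift of an edge starting in the cell [0] ends. *)
Definition edge_index f : 'rV[int]_d := (unplace (tgt (graph G) (edge_lift f))).2.

Lemma tgt_edge_lift f :
  tgt (graph G) (edge_lift f) = place (tgt (qgraph G) f, edge_index f).
Proof.
rewrite -[LHS]unplaceK /edge_index; congr place.
rewrite [LHS]surjective_pairing; congr pair.
by rewrite -vproj_place unplaceK -tgt_eproj eproj_edge_lift.
Qed.

Lemma edge_at_place e x : src (graph G) e = place x ->
  e = eshift x.2 (edge_lift (eproj e)).
Proof.
move=> ex; have [k ek] : exists k, e = eshift k (edge_lift (eproj e)).
  by apply/eproj_eq; rewrite eproj_edge_lift.
have w1 : src (qgraph G) (eproj e) = x.1 by rewrite src_eproj ex vproj_place.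
rewrite {1}ek; congr eshift; move: ex; rewrite {1}ek src_eshift src_edge_lift w1.
exact: vshift_free.
Qed.

Lemma edge_index_form : one_form (qgraph G) edge_index.
Proof.
move=> f; apply/eqP; rewrite -addr_eq0 addrC; apply/eqP.
have pr : eproj (inv (graph G) (edge_lift f)) = inv (qgraph G) f.
  by rewrite -inv_eproj eproj_edge_lift.
have := edge_at_place (e := inv (graph G) (edge_lift f))
  (x := (tgt (qgraph G) f, edge_index f)).
rewrite src_inv tgt_edge_lift => /(_ erefl); rewrite pr /= => ie.
have := congr1 (tgt (graph G)) ie.
rewrite tgt_inv src_edge_lift tgt_eshift tgt_edge_lift vshift_place /= => h.
have : place (src (qgraph G) f, 0) = place (tgt (qgraph G) (inv (qgraph G) f),
   edge_index f + edge_index (inv (qgraph G) f)).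
  rewrite -h /place /=; apply: (@pos_inj _ _ G); rewrite pos_vshift.
  by rewrite /lattice_point (_ : map_mx _ 0 = 0) ?mul0mx ?addr0//;
    apply/rowP => i; rewrite !mxE.
by move=> /place_inj [_ <-].
Qed.

(** The coordinate form differs from the index form by the difference of the
    positions of the representatives, whose flux through a cycle vanishes. *)
Lemma same_flux_edge_index : same_flux (qgraph G) (coordinate_form (G := G))
  (fun f => int_rV (edge_index f) : 'rV[R]_d).
Proof.
split=> [f|c [v cv]].
  by rewrite edge_index_form; apply/rowP => i; rewrite !mxE rmorphN.
pose h w : 'rV[R]_d := lattice_coord (basis G) (pos (representative w)).
have := flux_exact h cv; rewrite subrr => hc.
rewrite -[LHS]addr0 -[X in _ + X]hc /flux -big_split; apply: eq_bigr => f _ /=.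
rewrite -[in RHS](eproj_edge_lift f) coordinate_formE /edge_coord.
rewrite tgt_edge_lift src_edge_lift pos_vshift /lattice_coord mulmxDl.
rewrite /lattice_point mulmxK ?basis_unit// -/(int_rV _) /h /lattice_coord.
by rewrite addrA; congr (_ - _); rewrite addrC.
Qed.

Lemma sum_star x (F : edge G -> R[i]) :
  \sum_(e \in [set e | src (graph G) e = place x]) F e =
  \sum_(f | src (qgraph G) f == x.1) F (eshift x.2 (edge_lift f)).
Proof.
pose r := [seq f <- enum (qedge G) | src (qgraph G) f == x.1].
have ur : uniq r by rewrite filter_uniq// enum_uniq.
rewrite (@reindex_fsbig _ _ _ _ _ (fun f => eshift x.2 (edge_lift f)) [set` r]).
  by rewrite -fsbig_seq// big_filter big_enum_cond.
split.
- move=> f; rewrite /= mem_filter => /andP[/eqP fx _].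
  by rewrite src_eshift src_edge_lift fx.
- move=> f g _ _ /(congr1 (@eproj _ _ G)).
  by rewrite !eproj_eshift !eproj_edge_lift.
- move=> e /= ex; exists (eproj e); last by rewrite -(edge_at_place ex).
  by rewrite /= mem_filter mem_enum andbT src_eproj ex vproj_place.
Qed.

Lemma magnetic_schrodinger_place alpha (Q : vert G -> R) (z : R) F x :
  magnetic_potential alpha -> electric_potential Q ->
  magnetic_schrodinger alpha Q F (place x) - z%:C%C * F (place x) =
  periodic_hopping (qgraph G) edge_index (einduced alpha)
    (fun w => (degree (qgraph G) finset.setT w)%:R + vinduced Q w - z)
    (fun y => F (place y)) x.
Proof.
move=> [_ aP] QP; rewrite /magnetic_schrodinger /periodic_hopping sum_star.
rewrite rmorphB rmorphD rmorph_nat /= mulrBl mulrDl.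
have -> : Q (place x) = vinduced Q x.1 by rewrite -(vinducedE QP) vproj_place.
rewrite sumrB sumr_const mulr_natl.
have -> : #|fun f => src (qgraph G) f == x.1| = degree (qgraph G) finset.setT x.1.
  by apply: eq_card => f; rewrite !inE.
have -> : \sum_(f | src (qgraph G) f == x.1)
      expi (alpha (eshift x.2 (edge_lift f))) *
      F (tgt (graph G) (eshift x.2 (edge_lift f))) =
    \sum_(f | src (qgraph G) f == x.1)
      expi (einduced alpha f) * F (place (tgt (qgraph G) f, x.2 + edge_index f)).
  apply: eq_bigr => f _.
  rewrite aP tgt_eshift tgt_edge_lift vshift_place /=.
  by rewrite -(einducedE aP) eproj_edge_lift.
by ring.
Qed.

Lemma ell2_normsq_place (F : vert G -> R[i]) :
  ell2_normsq F = ell2_normsq (fun x => F (place x)).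
Proof.
rewrite /ell2_normsq (@reindex_esum _ _ _ setT setT place)//; split=> //.
  by move=> x y _ _; exact: place_inj.
by move=> v _; exists (unplace v) => //; exact: unplaceK.
Qed.

End LatticeCoordinates.

Section Spectrum.
Context {R : realType} {d : nat} (G : periodic_graph R d).
Variables (alpha : edge G -> R) (Q : vert G -> R) (m0 : qedge G -> 'rV[R]_d)
  (phi : qedge G -> R).
Hypotheses (alphaP : magnetic_potential alpha) (QP : electric_potential Q)
  (m0P : same_flux (qgraph G) (coordinate_form (G := G)) m0)
  (phiP : same_flux_mod2pi (qgraph G) (einduced alpha) phi).

Let bloch z := bloch_operator (qgraph G) (@edge_index _ _ G) (einduced alpha)
  (fun w => (degree (qgraph G) finset.setT w)%:R + vinduced Q w - z).

(** A vanishing determinant would make [x] an eigenvalue of a fiber, and by gauge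
    invariance an eigenvalue of the fiber that defines the bands. *)
Lemma bloch_det_neq0 (x : R) theta :
  (forall n : 'I_#|qvert G|, ~ band m0 phi Q n x) ->
  \det (operator_mx (bloch x theta)) != 0.
Proof.
move=> xband; apply/negP => /eqP det0.
pose M := operator_mx (fiber_operator (qgraph G) m0 phi (vinduced Q) theta).
pose M' := operator_mx (fiber_operator (qgraph G)
  (fun f => int_rV (edge_index f)) (einduced alpha) (vinduced Q) theta).
have MM' : char_poly M = char_poly M'.
  exact: (fiber_eigenvalues_gauge _ _ alphaP m0P phiP (same_flux_edge_index G)).
have bM : operator_mx (bloch x theta) = M' - x%:C%C%:M.
  apply/matrixP => i j; rewrite /M' fiber_operatorE !mxE /hopping_operator.
  rewrite /bloch /bloch_operator /hopping_operator /= rmorphB mulrBl addrAC; congr (_ - _ - _).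
  by rewrite (inj_eq enum_val_inj) mulr_natr.
have : root (char_poly M) x%:C%C.
  rewrite MM' -eigenvalue_root_char /eigenvalue /eigenspace -bM.
  by rewrite kermx_eq0 row_free_unit unitmxE det0 unitr0.
move=> /root_eigenvalues xM.
have szM : size (eigenvalues M) = #|qvert G| by exact: size_eigenvalues.
have ltM : (index x (eigenvalues M) < #|qvert G|)%N by rewrite -[X in (_ < X)%N]szM index_mem.
apply: (xband (Ordinal ltM)); exists theta => //.
exact: nth_index.
Qed.

(** Off the bands all fibers of [H - x] are invertible, and so is [H - x]. *)
Lemma spectrum_sub_bands : real_spectrum (magnetic_schrodinger alpha Q) `<=`
  \big[setU/set0]_(n < #|qvert G|) band m0 phi Q n.
Proof.
move=> x; apply: contraPP => xband; apply; rewrite /= -/(resolvent_set _ _).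
have xb n : ~ band m0 phi Q (n : 'I_#|qvert G|) x.
  move=> bx; apply: xband.
  exact: (@bigsetU_sup _ n _ (fun n => band m0 phi Q n) (ltn_ord n)).
have [S [[M SM] SP]] := periodic_hopping_inverse (@edge_index_form _ _ G)
  (einduced_form alphaP) (fun theta => bloch_det_neq0 theta xb).
exists (fun f v => S (fun y => f (place y)) (unplace v)); split.
  exists M => f ff; rewrite ell2_normsq_place (ell2_normsq_place f).
  under eq_fun do rewrite placeK.
  by apply: SM; rewrite /ell2 -ell2_normsq_place.
move=> f ff.
have [] := SP (fun y => f (place y)); first by rewrite /ell2 -ell2_normsq_place.
move=> SAf ASf; split; apply/funext => v; rewrite -(unplaceK v).
  rewrite placeK -[RHS](congr1 (fun g => g (unplace v)) SAf); congr (S _ _).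
  by apply/funext => y; rewrite magnetic_schrodinger_place.
rewrite magnetic_schrodinger_place// -[RHS](congr1 (fun g => g (unplace v)) ASf).
by congr (periodic_hopping _ _ _ _ _); apply/funext => y; rewrite placeK.
Qed.

Lemma spectrum_measure_le :
  (lebesgue_measure (real_spectrum (magnetic_schrodinger alpha Q))
   <= \sum_(n < #|qvert G|) lebesgue_measure (band m0 phi Q n))%E.
Proof.
apply: le_trans (lebesgue_measure_le spectrum_sub_bands) _.
exact: lebesgue_measure_bigsetU.
Qed.

End Spectrum.

(** * The integer line *)

Section Line.
Context {R : realType}.

(** [(n, true)] and [(n, false)] are the two orientations of the edge between
    [n] and [n + 1]. *)
Definition line_src (e : int * bool) : int := if e.2 then e.1 else e.1 + 1.
Definition line_tgt (e : int * bool) : int := if e.2 then e.1 + 1 else e.1.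
Definition line_inv (e : int * bool) : int * bool := (e.1, ~~ e.2).

Lemma line_invK : involutive line_inv.
Proof. by case=> n []. Qed.

Lemma line_inv_neq e : line_inv e <> e.
Proof. by case: e => n []. Qed.

Lemma line_src_inv e : line_src (line_inv e) = line_tgt e.
Proof. by case: e => n []. Qed.

Definition line_graph : multigraph int (int * bool) :=
  Multigraph line_invK line_inv_neq line_src_inv.

Definition loop_graph : multigraph unit bool :=
  @Multigraph unit bool (fun=> tt) (fun=> tt) negb negbK
    (fun b => match b with true => fun h => notF h | false => fun h => notF (esym h) end)
    (fun=> erefl).

Lemma line_connected : connected_graph line_graph.
Proof.
have up (n : nat) u : exists p, walk line_graph u p (u + n%:Z).
  elim: n => [|n [p up]]; first by exists [::]; rewrite /= addr0.
  exists (p ++ [:: (u + n%:Z, true)]); apply: (walk_cat up).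
  by split=> //=; rewrite /line_tgt /= -addrA; congr (_ + _); lia.
move=> u v; have [uv|vu] := leP u v.
  have [p pP] := up `|v - u|%N u; exists p.
  by have -> : v = u + `|v - u|%N%:Z by lia.
have [p pP] := up `|u - v|%N v; exists (rev_walk line_graph p).
by apply: walk_rev; have -> : u = v + `|u - v|%N%:Z by lia.
Qed.

Lemma line_infinite : infinite_set [set: int].
Proof.
move=> /(finite_image absz); apply: contra_not infinite_nat.
by apply: sub_finite_set => n _; exists n%:Z.
Qed.

Lemma line_star (n : int) : [set e | line_src e = n] =
  [set` [:: (n, true); (n - 1, false)]].
Proof.
apply/seteqP; split=> [[k []]|[k []]] /=; rewrite /line_src /= !inE !xpair_eqE /=.
- by move=> ->; rewrite eqxx.
- by move=> <-; rewrite addrK eqxx orbT.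
- by rewrite andbT andbF orbF => /eqP ->.
- by rewrite andbF andbT /= => /eqP ->; rewrite subrK.
Qed.

Lemma line_locally_finite : locally_finite line_graph.
Proof. by move=> n; rewrite (line_star n); exact: finite_seq. Qed.

Definition line_pos (n : int) : 'rV[R]_1 := const_mx n%:~R.

Lemma line_pos_inj : injective line_pos.
Proof. by move=> m n /rowP/(_ 0); rewrite !mxE => /intr_inj. Qed.

Definition line_vshift (k : 'rV[int]_1) (n : int) : int := n + k 0 0.
Definition line_eshift (k : 'rV[int]_1) (e : int * bool) : int * bool :=
  (e.1 + k 0 0, e.2).

Lemma line_pos_vshift k n :
  line_pos (line_vshift k n) = line_pos n + lattice_point 1%:M k.
Proof.
by apply/rowP => i; rewrite /lattice_point mulmx1 !mxE rmorphD ord1.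
Qed.

Lemma line_eshift0 e : line_eshift 0 e = e.
Proof. by case: e => n b; rewrite /line_eshift mxE addr0. Qed.

Lemma line_eshiftD k l e : line_eshift (k + l) e = line_eshift k (line_eshift l e).
Proof. by rewrite /line_eshift mxE /= -addrA [l 0 0 + _]addrC. Qed.

Lemma line_src_eshift k e :
  src line_graph (line_eshift k e) = line_vshift k (src line_graph e).
Proof. by case: e => n []; rewrite //= /line_src /line_vshift /= addrAC. Qed.

Lemma line_inv_eshift k e :
  inv line_graph (line_eshift k e) = line_eshift k (inv line_graph e).
Proof. by []. Qed.

Lemma line_vproj_surj (w : unit) : exists v : int, tt = w.
Proof. by exists 0; case: w. Qed.

Lemma line_eproj_surj (b : bool) : exists e : int * bool, e.2 = b.
Proof. by exists (0, b). Qed.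

Lemma line_vproj_eq (u v : int) : tt = tt <-> exists k, v = line_vshift k u.
Proof.
split=> // _; exists (const_mx (v - u)).
by rewrite /line_vshift mxE addrC subrK.
Qed.

Lemma line_eproj_eq (e f : int * bool) : e.2 = f.2 <-> exists k, f = line_eshift k e.
Proof.
split=> [ef|[k ->]//]; exists (const_mx (f.1 - e.1)).
by rewrite /line_eshift mxE addrC subrK ef; case: f {ef}.
Qed.

Definition line : periodic_graph R 1 :=
  @PeriodicGraph R 1 1%:M (unitmx1 _ _) int (int * bool)%type line_graph
    line_connected line_infinite line_locally_finite line_pos line_pos_inj
    line_vshift line_eshift line_pos_vshift line_eshift0 line_eshiftD
    line_src_eshift line_inv_eshift unit bool loop_graph (fun=> tt) snd
    line_vproj_surj line_eproj_surj line_vproj_eq line_eproj_eq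
    (fun=> erefl) (fun=> erefl).

Variables (alpha : edge line -> R) (Q : vert line -> R).
Hypotheses (alphaP : magnetic_potential alpha) (QP : electric_potential Q).

Let a := alpha (0, true).
Let q := Q 0.

Lemma line_potential n : Q n = q.
Proof. by rewrite /q -(QP (const_mx n) 0) /= /line_vshift mxE add0r. Qed.

Lemma line_magnetic n : alpha (n, true) = a /\ alpha (n, false) = - a.
Proof.
have an : alpha (n, true) = a.
  by rewrite /a -(alphaP.2 (const_mx n) (0, true)) /= /line_eshift mxE add0r.
by split=> //; rewrite -an -(alphaP.1 (n, true)).
Qed.

Lemma line_schrodinger (f : int -> R[i]) n :
  magnetic_schrodinger alpha Q f n =
  (2 + q)%:C%C * f n - expi a * f (n + 1) - (expi a)^* * f (n - 1).
Proof.
rewrite /magnetic_schrodinger /= line_star -fsbig_seq; last first.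
  by rewrite /= inE xpair_eqE andbF.
rewrite big_cons big_seq1 /line_tgt /= line_potential.
have [-> _] := line_magnetic n; have [_ ->] := line_magnetic (n - 1).
by rewrite expiN rmorphD /= [2%:C%C]rmorph_nat; ring.
Qed.

Section PlaneWave.
Variables (t : R) (N : nat).

(* the momentum t - a compensates the magnetic phase a of a step to the right *)

Let ind (n : int) : R := ((0 <= n) && (n < N%:Z))%:R.
Let wave (n : int) : R[i] := (ind n)%:C%C * expi ((t - a) * n%:~R).

Let defect (n : int) : R[i] :=
  magnetic_schrodinger alpha Q wave n - (2 + q - 2 * cos t)%:C%C * wave n.

(** Away from the ends of the interval the plane wave is an eigenfunction. *)
Lemma defectE n : defect n = expi ((t - a) * n%:~R) *
  ((ind n - ind (n + 1))%:C%C * expi t + (ind n - ind (n - 1))%:C%C * expi (- t)).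
Proof.
have ct : (2 * cos t)%:C%C = expi t + expi (- t) :> R[i].
  rewrite expiN; apply/eqP; rewrite eq_complex ReD ImD /=.
  by apply/andP; split; apply/eqP; lra.
have e1 z : expi a * (z * expi ((t - a) * (n + 1)%:~R)) =
    z * (expi t * expi ((t - a) * n%:~R)).
  rewrite mulrCA; congr (_ * _).
  by rewrite -!expiD rmorphD /=; congr expi; ring.
have e2 z : (expi a)^* * (z * expi ((t - a) * (n - 1)%:~R)) =
    z * (expi (- t) * expi ((t - a) * n%:~R)).
  rewrite mulrCA; congr (_ * _).
  by rewrite -expiN -!expiD rmorphB /=; congr expi; ring.
rewrite /defect line_schrodinger /wave e1 e2.
rewrite [in (2 + q - _)%:C%C]rmorphB /= ct !rmorphB /=.
by ring.
Qed.

Lemma sumsq_defect : ell2_le defect 16.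
Proof.
pose s := undup [:: -1; 0; N%:Z - 1; N%:Z].
have ds : supported s defect.
  move=> n; rewrite mem_undup !inE !negb_or => /and4P[n1 n2 n3 n4].
  rewrite defectE.
  have -> : ind (n + 1) = ind n by rewrite /ind; congr (_%:R); lia.
  have -> : ind (n - 1) = ind n by rewrite /ind; congr (_%:R); lia.
  by rewrite subrr !mul0r addr0 mulr0.
have us : uniq s by exact: undup_uniq.
move=> r ur; apply: le_trans (supported_ell2_le ds us ur) _.
have d4 n : normsq (defect n) <= 4.
  rewrite defectE normsqM normsq_expi mul1r.
  apply: le_trans (normsqD_le _ _) _.
  rewrite !normsqM !normsq_expi !normsq_real !mulr1.
  have ind01 m : ind m = 0 \/ ind m = 1 by rewrite /ind; case: (_ && _); auto.
  by case: (ind01 n) => ->; case: (ind01 (n + 1)) => ->;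
    case: (ind01 (n - 1)) => ->; lra.
apply: (@le_trans _ _ (\sum_(n <- s) 4)); first by apply: ler_sum.
rewrite big_const_seq iter_addr_0 count_predT -mulr_natr.
have : (size s <= 4)%N by apply: leq_trans (size_undup _) _.
by rewrite -(ler_nat R); lra.
Qed.

Lemma sumsq_wave : exists2 s, uniq s & sumsq s wave = N%:R /\ supported s wave.
Proof.
exists [seq n%:Z | n <- iota 0 N]; first by rewrite map_inj_uniq ?iota_uniq// => m n [].
split.
  rewrite /sumsq big_map (eq_big_seq (fun=> 1)); last first.
    move=> n; rewrite mem_iota add0n => /andP[_ nN].
    rewrite /wave normsqM normsq_expi mulr1 normsq_real /ind.
    have -> : (0 <= n%:Z) && (n%:Z < N%:Z) by lia.
    by rewrite expr1n.
  by rewrite big_const_seq iter_addr_0 count_predT size_iota.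
move=> n ns; rewrite /wave /ind.
case: (boolP (_ && _)) => [/andP[n0 nN]|_]; last by rewrite mul0r.
case/negP: ns; apply/mapP; exists `|n|%N; last by lia.
by rewrite mem_iota; lia.
Qed.

End PlaneWave.

(** A bounded inverse would bound the number of sites of the plane wave by its
    defect, which comes from four sites only. *)
Lemma line_spectrum t :
  real_spectrum (magnetic_schrodinger alpha Q) (2 + q - 2 * cos t).
Proof.
rewrite /real_spectrum /= /spectrum /= => -[S [[M SM] SP]].
pose N := (Num.truncn (16 * `|M|)).+1.
have [s us [sN ss]] := sumsq_wave t N.
set f := (fun n => _) in sN ss.
pose g n := magnetic_schrodinger alpha Q f n - (2 + q - 2 * cos t)%:C%C * f n.
have g2 : ell2_le g 16 := sumsq_defect t N.
have f2 : ell2 f by apply/ell2P; eexists; exact: supported_ell2_le ss us.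
have [Sf _] := SP f f2.
have := SM g (proj2 (ell2P _) (ex_intro _ _ g2)); rewrite Sf => bound.
have : (ell2_normsq f <= (16 * `|M|)%:E)%E.
  apply: le_trans bound _.
  apply: (@le_trans _ _ (`|M|%:E * ell2_normsq g)%E).
    apply: lee_wpmul2r; last by rewrite lee_fin ler_norm.
    by apply: esum_ge0 => v _; rewrite lee_fin normsq_ge0.
  rewrite mulrC EFinM; apply: lee_wpmul2l; first by rewrite lee_fin.
  exact/ell2_normsqP.
move=> /ell2_normsqP/(_ s us); rewrite sN leNgt => /negP; apply.
exact: truncnS_gt.
Qed.

Lemma line_spectrum_itv : `[q, q + 4] `<=`
  real_spectrum (magnetic_schrodinger alpha Q).
Proof.
move=> y; rewrite /= in_itv /= => /andP[qy yq].
have -> : y = 2 + q - 2 * cos (acos ((2 + q - y) / 2)).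
  by rewrite acosK ?in_itv/=; lra.
exact: line_spectrum.
Qed.

Lemma line_spectrum_measure :
  (4%:E <= lebesgue_measure (real_spectrum (magnetic_schrodinger alpha Q)))%E.
Proof.
apply: le_trans (lebesgue_measure_le line_spectrum_itv).
by rewrite lebesgue_measure_itv /= lte_fin ltrDl ltr0n /= -EFinD lee_fin; lra.
Qed.

End Line.

(** * Spectral estimates *)

(* The bands do not depend on the minimal forms (m0, phi) used to define them, *)
(* so these are chosen independently of the minimal form m in the estimates.   *)
Theorem theorem2p5 (R : realType) :
  (forall (d : nat) (G : periodic_graph R d)
          (alpha : edge G -> R) (Q : vert G -> R)
          (m0 : qedge G -> 'rV[R]_d) (phi : qedge G -> R)
          (m : qedge G -> 'rV[R]_d),
     magnetic_potential alpha ->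
     electric_potential Q ->
     minimal_coordinate_form m0 ->
     minimal_magnetic_form alpha phi ->
     minimal_coordinate_form m ->
     (forall n : 'I_#|qvert G|,
        band m0 phi Q n `<=`
          `[unperturbed_eigenvalue m alpha Q n,
            unperturbed_eigenvalue m alpha Q n + 2 * (max_degree m)%:R])
     /\
     ((lebesgue_measure (real_spectrum (magnetic_schrodinger alpha Q))
         <= \sum_(n < #|qvert G|) lebesgue_measure (band m0 phi Q n))%E
      /\
      (\sum_(n < #|qvert G|) lebesgue_measure (band m0 phi Q n)
         <= (4 * invariant_I m)%:E)%E))
  /\
  (exists (d : nat) (G : periodic_graph R d),
     forall (alpha : edge G -> R) (Q : vert G -> R)
            (m0 : qedge G -> 'rV[R]_d) (phi : qedge G -> R)
            (m : qedge G -> 'rV[R]_d),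
       magnetic_potential alpha ->
       electric_potential Q ->
       minimal_coordinate_form m0 ->
       minimal_magnetic_form alpha phi ->
       minimal_coordinate_form m ->
       lebesgue_measure (real_spectrum (magnetic_schrodinger alpha Q))
         = (\sum_(n < #|qvert G|) lebesgue_measure (band m0 phi Q n))%E
       /\
       (\sum_(n < #|qvert G|) lebesgue_measure (band m0 phi Q n))%E
         = (4 * invariant_I m)%:E).
Proof.
split.
  move=> d G alpha Q m0 phi m alphaP QP [m0P _] [phiP _] [mP _].
  split; first by move=> n; exact: band_itv.
  by split; [exact: spectrum_measure_le|exact: sum_bands_le alphaP m0P phiP mP].
exists 1%N, line => alpha Q m0 phi m alphaP QP [m0P _] [phiP _] [mP _].
have le1 := spectrum_measure_le alphaP QP m0P phiP.
have le2 := sum_bands_le Q alphaP m0P phiP mP.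
have le3 : ((4 * invariant_I m)%:E <= 4%:E :> \bar R)%E.
  rewrite lee_fin /invariant_I.
  have E2 : #|qedge (@line R)| = 2%N by exact: card_bool.
  by have := max_card (mem (supp m)); rewrite E2 -(ler_nat R); lra.
have ge := line_spectrum_measure alphaP QP.
split; apply/le_anti/andP; split=> //.
  exact: le_trans le2 (le_trans le3 ge).
exact: le_trans le3 (le_trans ge le1).
Qed.
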